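(* Let $Z,W,A_\star,B_\star$, the data points $\{u(t_i),x(t_i),\dot x(t_i)\}_{i=0}^{T-1}$ and $\delta>0$ be as in the context (in particular, the data satisfy $\dot x(t_i)=A_\star Z(x(t_i))+B_\star W(x(t_i))u(t_i)+d(t_i)$ with $|d(t_i)|^2\le\delta$ for all $i$). Let the optimization program (OPT) in the context be feasible, let $\bar{\mathbf A},\bar{\mathbf B}$ be a solution of it, and let $\bar{\boldsymbol\zeta}:=-\bar{\mathbf A}^{-1}\bar{\mathbf B}$, $\bar{\mathbf Q}:=I_n$ and $\bar{\mathcal I}$ be the corresponding objects defined in the context. Suppose there exist a scalar $\mu>0$, a polynomial vector $k:\mathbb R^n\to\mathbb R^m$ with $k(0)=0$, polynomials $\alpha_1,\dots,\alpha_4$ (in one variable $r$), $V$ (in $x\in\mathbb R^n$), $\lambda$ (in $(x,w)\in\mathbb R^n\times\mathbb R^m$), SOS polynomials $s_{\alpha_1}$, $s_{\alpha_2}$ (in $x$), $s_\lambda$ (in $(x,w)$) and an SOS polynomial matrix $S_\nabla$ (in $(x,w)$) such that for all $r\in\mathbb R$, $x\in\mathbb R^n$ and $w\in\mathbb R^m$: (a) for $i=1,\dots,4$, $\alpha_i(r)=\sum_{j=1}^{N_i}c_{ij}r^{2j}$ for some integer $N_i\ge1$ and scalars $c_{i1}\ge0,\dots,c_{iN_i}\ge0$ with $\sum_{j=1}^{N_i}c_{ij}\ge\mu$; (b) $V(x)-\alpha_1(|x|)=s_{\alpha_1}(x)$ and $\alpha_2(|x|)-V(x)=s_{\alpha_2}(x)$;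 (c) $\lambda(x,w)-\mu=s_\lambda(x,w)$; (d) with $\ell(x,w):=\begin{bmatrix}Z(x)\\ W(x)(k(x)+w)\end{bmatrix}$, $$\begin{bmatrix}\alpha_3(|x|)-\alpha_4(|w|)+\frac{\partial V}{\partial x}(x)\,\bar{\boldsymbol\zeta}^\top \ell(x,w) & \star & \star\\ \bar{\mathbf Q}^{1/2}\frac{\partial V}{\partial x}(x)^\top & -2\lambda(x,w)I & \star\\ \lambda(x,w)\bar{\mathbf A}^{-1/2}\ell(x,w) & 0 & -2\lambda(x,w)I\end{bmatrix}=-S_\nabla(x,w).$$ Then, for all $[A\ \,B]\in\bar{\mathcal I}$, and in particular for $[A_\star\ \,B_\star]$, the system $$\dot x=[A\ \,B]\begin{bmatrix}Z(x)\\ W(x)(k(x)+w)\end{bmatrix}$$ is input-to-state stable (ISS) with respect to the actuator disturbance $w\in\mathbb R^m$.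
   Context: System and libraries. $x\in\mathbb R^n$ is the state and $u\in\mathbb R^m$ the input. $Z:\mathbb R^n\to\mathbb R^N$ and $W:\mathbb R^n\to\mathbb R^{M\times m}$ are known function libraries whose elements are monomials of $x$, with $Z(0)=0$. The actual system is $\dot x=A_\star Z(x)+B_\star W(x)u$ for (unknown) constant matrices $A_\star\in\mathbb R^{n\times N}$, $B_\star\in\mathbb R^{n\times M}$. Data. There are $T$ data points $(u(t_i),x(t_i),\dot x(t_i))\in\mathbb R^m\times\mathbb R^n\times\mathbb R^n$, $i=0,\dots,T-1$, satisfying $\dot x(t_i)=A_\star Z(x(t_i))+B_\star W(x(t_i))u(t_i)+d(t_i)$ for some noise samples with $|d(t_i)|^2\le\delta$, where $\delta>0$ is known. Optimization program. Let $\ell_i:=\begin{bmatrix}Z(x(t_i))\\ W(x(t_i))u(t_i)\end{bmatrix}$, $\boldsymbol C_i:=\dot x(t_i)\dot x(t_i)^\top-\delta I$, $\boldsymbol B_i:=-\ell_i\dot x(t_i)^\top$, $\boldsymbol A_i:=\ell_i\ell_i^\top$. The program (OPT) is: minimize $-\log\det\bar{\mathbf A}$ over symmetric $\bar{\mathbf A}\in\mathbb R^{(N+M)\times(N+M)}$, $\bar{\mathbf B}\in\mathbb R^{(N+M)\times n}$ and scalars $\tau_0,\dots,\tau_{T-1}$, subject to $\bar{\mathbf A}\succ0$, $\tau_0\ge0,\dots,\tau_{T-1}\ge0$ and $$\begin{bmatrix}-I-\sum_{i}\tau_i\boldsymbol C_i&\star&\star\\ \bar{\mathbf B}-\sum_i\tau_i\boldsymbol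 B_i&\bar{\mathbf A}-\sum_i\tau_i\boldsymbol A_i&\star\\ \bar{\mathbf B}&0&-\bar{\mathbf A}\end{bmatrix}\preceq0.$$ The set $\bar{\mathcal I}$. For a solution $\bar{\mathbf A},\bar{\mathbf B}$ of (OPT), $$\bar{\mathcal I}:=\{[A\ \,B]=\zeta^\top:\ \bar{\mathbf B}^\top\bar{\mathbf A}^{-1}\bar{\mathbf B}+\bar{\mathbf B}^\top\zeta+\zeta^\top\bar{\mathbf B}+\zeta^\top\bar{\mathbf A}\zeta\preceq I\},$$ with $A\in\mathbb R^{n\times N}$, $B\in\mathbb R^{n\times M}$. Equivalently, $\bar{\mathcal I}=\{(\bar{\boldsymbol\zeta}+\bar{\mathbf A}^{-1/2}\Upsilon\bar{\mathbf Q}^{1/2})^\top:\|\Upsilon\|\le1\}$ with $\|\cdot\|$ the induced 2-norm. Notation. $|\cdot|$ is the Euclidean norm; $\succ,\succeq,\preceq$ refer to the semidefinite order on symmetric matrices; $A^{1/2}$ is the positive semidefinite square root; $\star$ denotes the blocks making a matrix symmetric; $\frac{\partial V}{\partial x}$ is the row vector of partial derivatives. A polynomial is SOS if it is a sum of squares of polynomials; a symmetric polynomial matrix $S$ is SOS if $S=R^\top R$ for some polynomial matrix $R$. ISS. A continuous $\gamma:[0,\infty)\to[0,\infty)$ is of class $\mathcal K$ if it is strictly increasing and $\gamma(0)=0$. A continuous $\beta:[0,\infty)\times[0,\infty)\to[0,\infty)$ is of class $\mathcal{KL}$ if $\beta(\cdot,s)$ is of class $\mathcal K$ for each fixed $s$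 and, for each fixed $r$, $\beta(r,\cdot)$ is decreasing with $\lim_{s\to\infty}\beta(r,s)=0$. A system $\dot x=F(x,v)$, $F(0,0)=0$, $F$ locally Lipschitz, with input $v\in\mathbb R^p$, is ISS with respect to $v$ if there exist $\beta$ of class $\mathcal{KL}$ and $\gamma$ of class $\mathcal K$ such that for each $x^\circ\in\mathbb R^n$ and each piecewise continuous bounded $v:[0,\infty)\to\mathbb R^p$, the solution with $x(0)=x^\circ$ satisfies $|x(t)|\le\beta(|x^\circ|,t)+\gamma(\sup_{s\ge0}|v(s)|)$ for all $t\ge0$. *)

(* Defs.v *)
(* Vectors of R^n are columns 'cV[R]_n, polynomials in n
   variables are {mpoly R[n]}, and polynomial vectors and matrices are matrices
   over {mpoly R[n]}. *)
From HB Require Import structures.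
From mathcomp Require Import all_boot all_order all_algebra.
From mathcomp Require Import all_classical all_reals all_analysis.
(* Importing the notations of mpoly together with those of analysis fails. *)
From mathcomp Require Import -(notations) mpoly.

Set Implicit Arguments.
Unset Strict Implicit.
Unset Printing Implicit Defensive.

Import Order.TTheory GRing.Theory Num.Theory.
Import numFieldNormedType.Exports.

Local Open Scope classical_set_scope.
Local Open Scope ring_scope.

Notation mpolynomial R n := (mpoly.mpoly n R).

Section Matrices.
Context {R : realType}.

Definition enorm n (x : 'cV[R]_n) : R := Num.sqrt (\sum_(i < n) x i 0 ^+ 2).

Definition psdmx n (X : 'M[R]_n) : Prop :=
  X^T = X /\ forall v : 'cV[R]_n, 0 <= (v^T *m X *m v) 0 0.

Definition pdmx n (X : 'M[R]_n) : Prop :=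
  X^T = X /\ forall v : 'cV[R]_n, v != 0 -> 0 < (v^T *m X *m v) 0 0.

Definition loewner_le n (X Y : 'M[R]_n) : Prop := psdmx (Y - X).

(* The positive semidefinite square root, which exists and is unique when X is
   positive semidefinite. *)
Definition sqrtmx n (X : 'M[R]_n) : 'M[R]_n :=
  xget 0 [set Y : 'M[R]_n | psdmx Y /\ Y *m Y = X].

(* The symmetric block matrix with the given blocks on and below the
   diagonal. *)
Definition symblock3 p q r
    (X11 : 'M[R]_p)
    (X21 : 'M[R]_(q, p)) (X22 : 'M[R]_q)
    (X31 : 'M[R]_(r, p)) (X32 : 'M[R]_(r, q)) (X33 : 'M[R]_r) :
    'M[R]_(p + q + r) :=
  block_mx (block_mx X11 X21^T X21 X22) (col_mx X31^T X32^T)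
           (row_mx X31 X32)             X33.

End Matrices.

Section Polynomials.
Context {R : realType}.

Definition peval n (x : 'cV[R]_n) (p : mpolynomial R n) : R :=
  meval (fun i => x i 0) p.

(* Evaluation at (x, w) of a polynomial in n + m variables. *)
Definition peval2 n m (x : 'cV[R]_n) (w : 'cV[R]_m)
    (p : mpolynomial R (n + m)) : R :=
  peval (col_mx x w) p.

(* A scalar times a power product; the scalar may be zero, so that W may have
   zero entries. *)
Definition is_monomial n (p : mpolynomial R n) : Prop :=
  exists (c : R) (a : multinom n), p = c *: mpolyX R a.

Definition gradient n (p : mpolynomial R n) (x : 'cV[R]_n) : 'rV[R]_n :=
  \row_i peval x (mderiv i p).

Definition sos n (p : mpolynomial R n) : Prop :=
  exists s : seq (mpolynomial R n), p = \sum_(q <- s) q ^+ 2.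

Definition sosmx n d (S : 'M[mpolynomial R n]_d) : Prop :=
  exists (e : nat) (P : 'M[mpolynomial R n]_(e, d)), S = P^T *m P.

Definition even_comparison (mu : R) (a : {poly R}) : Prop :=
  exists (N : nat) (c : nat -> R),
    [/\ (1 <= N)%N,
        forall j, (1 <= j <= N)%N -> 0 <= c j,
        mu <= \sum_(1 <= j < N.+1) c j
      & forall r : R, a.[r] = \sum_(1 <= j < N.+1) c j * r ^+ (2 * j)].

End Polynomials.

Section System.
Context {R : realType} {n m N M : nat}.
Variables (Z : 'cV[mpolynomial R n]_N) (W : 'M[mpolynomial R n]_(M, m)).

Definition regressor (x : 'cV[R]_n) (u : 'cV[R]_m) : 'cV[R]_(N + M) :=
  col_mx (map_mx (peval x) Z) (map_mx (peval x) W *m u).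

Definition closed_loop (A : 'M[R]_(n, N)) (B : 'M[R]_(n, M))
    (k : 'cV[mpolynomial R n]_m) (x : 'cV[R]_n) (w : 'cV[R]_m) : 'cV[R]_n :=
  row_mx A B *m regressor x (map_mx (peval x) k + w).

Context {T : nat}.
(* The data point measured at time t_i is (us i, xs i, xdots i). *)
Variables (us : 'I_T -> 'cV[R]_m) (xs xdots : 'I_T -> 'cV[R]_n) (delta : R).

Definition dataC (i : 'I_T) : 'M[R]_n :=
  xdots i *m (xdots i)^T - delta%:M.

Definition dataB (i : 'I_T) : 'M[R]_(N + M, n) :=
  - (regressor (xs i) (us i) *m (xdots i)^T).

Definition dataA (i : 'I_T) : 'M[R]_(N + M) :=
  regressor (xs i) (us i) *m (regressor (xs i) (us i))^T.

Definition opt_feasible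
    (Abar : 'M[R]_(N + M)) (Bbar : 'M[R]_(N + M, n)) (tau : 'I_T -> R) : Prop :=
  [/\ pdmx Abar,
      forall i, 0 <= tau i
    & loewner_le
        (symblock3
          (- 1%:M - \sum_(i < T) tau i *: dataC i)
          (Bbar - \sum_(i < T) tau i *: dataB i)
                                 (Abar - \sum_(i < T) tau i *: dataA i)
          Bbar                   0                             (- Abar))
        0].

Definition opt_solution
    (Abar : 'M[R]_(N + M)) (Bbar : 'M[R]_(N + M, n)) : Prop :=
  exists tau, opt_feasible Abar Bbar tau /\
    forall Abar' Bbar' tau', opt_feasible Abar' Bbar' tau' ->
      - ln (\det Abar) <= - ln (\det Abar').

End System.

Definition Ibar {R : realType} {n L : nat}
    (Abar : 'M[R]_L) (Bbar : 'M[R]_(L, n)) : set 'M[R]_(n, L) :=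
  [set zeta^T | zeta in [set zeta : 'M[R]_(L, n) |
    loewner_le (Bbar^T *m invmx Abar *m Bbar + Bbar^T *m zeta
                + zeta^T *m Bbar + zeta^T *m Abar *m zeta) 1%:M]].

Section ISS.
Context {R : realType}.

(* Functions on [0, +oo[ are total functions on R of which only the values on
   [0, +oo[ matter. *)
Definition class_K (g : R -> R) : Prop :=
  [/\ {within `[0, +oo[, continuous g},
      {in `[0, +oo[ &, {homo g : r s / r < s}}
    & g 0 = 0].

(* "Decreasing" is non-strict, since b 0 is identically 0. *)
Definition class_KL (b : R -> R -> R) : Prop :=
  [/\ {within [set p : R * R | 0 <= p.1 /\ 0 <= p.2],
         continuous (fun p => b p.1 p.2)},
      forall s, 0 <= s -> class_K (b^~ s),
      forall r, 0 <= r -> {in `[0, +oo[ &, {homo b r : s t /~ s <= t}}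
    & forall r, 0 <= r -> b r s @[s --> +oo] --> 0].

(* On every bounded interval [0, tmax], v is continuous except at finitely many
   points and has one-sided limits everywhere. *)
Definition piecewise_continuous p (v : R -> 'cV[R]_p) : Prop :=
  forall tmax : R, 0 < tmax ->
    [/\ exists D : seq R, forall t, 0 < t < tmax -> t \notin D ->
          {for t, continuous v},
        forall t, 0 <= t < tmax -> cvg (v s @[s --> t^'+])
      & forall t, 0 < t <= tmax -> cvg (v s @[s --> t^'-])].

Definition bounded_input p (v : R -> 'cV[R]_p) : Prop :=
  exists C : R, forall s, 0 <= s -> enorm (v s) <= C.

Definition input_sup p (v : R -> 'cV[R]_p) : R :=
  sup [set enorm (v s) | s in `[0, +oo[].

(* A continuous x on [0, +oo[ that satisfies the differential equation wherever
   the input is continuous; for piecewise continuous v this is the integral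
   equation x t = x0 + \int_0^t F (x s) (v s) ds. *)
Definition solution n p (F : 'cV[R]_n -> 'cV[R]_p -> 'cV[R]_n)
    (v : R -> 'cV[R]_p) (x0 : 'cV[R]_n) (x : R -> 'cV[R]_n) : Prop :=
  [/\ x 0 = x0,
      {within `[0, +oo[, continuous x}
    & forall t : R, 0 < t -> {for t, continuous v} ->
        is_derive t 1 x (F (x t) (v t))].

Definition locally_lipschitz n p (F : 'cV[R]_n -> 'cV[R]_p -> 'cV[R]_n) : Prop :=
  forall z : 'cV[R]_n * 'cV[R]_p, exists2 U : set ('cV[R]_n * 'cV[R]_p),
    nbhs z U & [lipschitz F y.1 y.2 | y in U].

(* "The solution satisfies the estimate for all t >= 0" includes the existence
   of a solution on the whole of [0, +oo[. *)
Definition ISS n p (F : 'cV[R]_n -> 'cV[R]_p -> 'cV[R]_n) : Prop :=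
  [/\ F 0 0 = 0,
      locally_lipschitz F
    & exists (b : R -> R -> R) (g : R -> R),
      [/\ class_KL b, class_K g
        & forall (x0 : 'cV[R]_n) (v : R -> 'cV[R]_p),
            piecewise_continuous v -> bounded_input v ->
            (exists x, solution F v x0 x) /\
            (forall x, solution F v x0 x -> forall t, 0 <= t ->
               enorm (x t) <= b (enorm x0) t + g (input_sup v))]].

End ISS.

(* Main.v *)
(* Completing the square in the definition of Ibar turns membership of
   [A B] = zeta^T into D^T Abar D <= I for D = zeta - zetabar.  Testing the
   matrix inequality (d) on (1, grad V^T / (2 lambda), Abar^(-1/2) l / 2) and
   absorbing grad V D^T l by Young's inequality with weight lambda gives the
   dissipation inequality
     grad V . F(x, w) <= - alpha3(|x|) + alpha4(|w|)
   for all [A B] in Ibar.  The true matrices lie in Ibar by the S-procedure.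

   The ISS estimate avoids a comparison principle.  With explicit right
   inverses b_i of alpha_i, as long as V exceeds alpha2(b3(2 alpha4(|w|))) it
   decreases at rate at least alpha3(|x|)/2, so either V(x(T)) is below that
   level or V decreased on all of [0, T] at a rate that is bounded below in
   terms of V(x(T)); integrating gives a bound on V(x(T)) in terms of
   alpha2(|x0|)/(1 + T), which is jointly continuous.

   Solutions exist globally: Picard iteration for the vector field truncated
   outside a large box gives a global solution, and the same estimate shows
   that it never reaches the boundary of the box. *)
Require Import Defs.
From HB Require Import structures.
From mathcomp Require Import all_boot all_order all_algebra.
From mathcomp Require Import all_classical all_reals all_analysis.
From mathcomp Require Import -(notations) mpoly.
From mathcomp Require Import ring lra complex spectral.

Set Implicit Arguments.
Unset Strict Implicit.
Unset Printing Implicit Defensive.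

Import Order.TTheory GRing.Theory Num.Theory.
Import numFieldNormedType.Exports.

Local Open Scope classical_set_scope.
Local Open Scope ring_scope.

(** * Square roots of positive definite matrices *)

(** Newton interpolation: a new node [a] is met by adding a multiple of the product of the X - y
    over the old nodes, which vanishes at these and not at [a]. *)
Lemma poly_interpolation (F : fieldType) (f : F -> F) (s : seq F) :
  exists t : {poly F}, forall x, x \in s -> t.[x] = f x.
Proof.
elim: s => [|a s [t tf]]; first by exists 0.
have [as_|ans] := boolP (a \in s).
  by exists t => x; rewrite inE => /orP[/eqP ->|]; exact: tf.
pose q := \prod_(y <- s) ('X - y%:P).
have qa : q.[a] != 0 by rewrite -rootE root_prod_XsubC.
exists (t + ((f a - t.[a]) / q.[a]) *: q) => x.
rewrite inE hornerD hornerZ => /orP[/eqP ->|xs].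
  by rewrite mulfVK// addrC subrK.
have /eqP -> : q.[x] == 0 by rewrite -rootE root_prod_XsubC.
by rewrite mulr0 addr0 tf.
Qed.

Lemma diagonalized_eigenvalue (F : fieldType) n (A P : 'M[F]_n) (d : 'rV[F]_n) :
  P \in unitmx -> A = invmx P *m diag_mx d *m P ->
  forall i, eigenvalue A (d 0 i).
Proof.
move=> Pu AE i; apply/eigenvalueP; exists (row i P).
  have PA : P *m A = diag_mx d *m P.
    by rewrite [in LHS]AE !mulmxA mulmxV// mul1mx.
  by rewrite -row_mul PA mul_diag_mx; apply/rowP => j; rewrite !mxE.
apply/eqP => Pi0; have := mulmxV Pu => /row_matrixP/(_ i).
rewrite row_mul Pi0 mul0mx => /rowP/(_ i); rewrite !mxE eqxx.
by move=> /eqP; rewrite eq_sym oner_eq0.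
Qed.

(** Polynomial evaluation commutes with conjugation and acts entrywise on a diagonal matrix, so only
    the values at the eigenvalues count. *)
Lemma horner_mx_fixed (F : fieldType) n (A P : 'M[F]_n.+1) (d : 'rV[F]_n.+1)
    (p : {poly F}) :
  P \in unitmx -> A = invmx P *m diag_mx d *m P ->
  (forall i, p.[d 0 i] = d 0 i) -> horner_mx A p = A.
Proof.
move=> Pu AE pd; rewrite {1}AE horner_mx_uconjC// horner_mx_diag [RHS]AE.
by congr (_ *m diag_mx _ *m _); apply/rowP => i; rewrite !mxE pd.
Qed.

Section MatrixSquareRoot.
Context {R : realType}.

Lemma dotE n (u v : 'cV[R]_n) : (u^T *m v) 0 0 = \sum_i u i 0 * v i 0.
Proof. by rewrite mxE; apply: eq_bigr => i _; rewrite mxE. Qed.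

Lemma dot_ge0 n (v : 'cV[R]_n) : 0 <= (v^T *m v) 0 0.
Proof. by rewrite dotE sumr_ge0// => i _; rewrite -expr2 sqr_ge0. Qed.

Lemma dot_eq0 n (v : 'cV[R]_n) : (v^T *m v) 0 0 = 0 -> v = 0.
Proof.
rewrite dotE => /eqP; rewrite psumr_eq0; last first.
  by move=> i _; rewrite -expr2 sqr_ge0.
move=> /allP h; apply/colP => i; rewrite mxE.
by have := h i (mem_index_enum i); rewrite /= -expr2 sqrf_eq0 => /eqP.
Qed.

Lemma pdmx_unit n (A : 'M[R]_n) : pdmx A -> A \in unitmx.
Proof.
move=> [_ pd]; rewrite -row_free_unit -kermx_eq0; apply/rowV0P => u /sub_kermxP uA.
apply/eqP; case: eqVneq => // u0.
have := pd u^T; rewrite trmxK uA mul0mx mxE ltxx -[0]trmx0 (inj_eq trmx_inj).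
by move=> /(_ u0).
Qed.

Lemma real_eigenvalue_pdmx n (A : 'M[R]_n) (a : R) :
  pdmx A -> eigenvalue A a -> 0 < a.
Proof.
move=> [At pd] /eigenvalueP[u uA u0].
have := pd u^T; rewrite trmxK uA -scalemxAl [X in _ < X]mxE.
rewrite -[0]trmx0 (inj_eq trmx_inj) => /(_ u0).
have ge0 := dot_ge0 u^T; rewrite trmxK in ge0.
by have [//|a0] := ltP 0 a; rewrite ltNge mulr_le0_ge0.
Qed.

Section ComplexDiagonalization.
Variables (C : numClosedFieldType) (toC : {rmorphism R -> C}) (re : C -> R).
Hypotheses (toC_real : forall x, toC x \is Num.real)
  (reK : forall z, z \is Num.real -> toC (re z) = z).

(** Over [C] the matrix is Hermitian, hence unitarily diagonalizable with real eigenvalues. [P] may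
    stay complex, because only polynomial identities in [A] are brought back to [R]. *)
Lemma symmetric_diagonalization n (A : 'M[R]_n) : A^T = A ->
  exists (P : 'M[C]_n) (d : 'rV[R]_n), P \in unitmx /\
    map_mx toC A = invmx P *m diag_mx (map_mx toC d) *m P.
Proof.
move=> At; pose AC := map_mx toC A.
have ACh : AC \is hermsymmx.
  apply: realsym_hermsym; last by apply/mxOverP => i j; rewrite mxE.
  by apply/is_hermitianmxP; rewrite expr0 scale1r map_mx_id// /AC map_trmx At.
exists (spectralmx AC), (map_mx re (spectral_diag AC)).
split; first exact: spectral_unit.
have -> : map_mx toC (map_mx re (spectral_diag AC)) = spectral_diag AC.
  apply/rowP => i; rewrite !mxE reK//.
  exact: (mxOverP (hermitian_spectral_diag_real ACh)).
exact: orthomx_spectralP (hermitian_normalmx ACh).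
Qed.

(* A polynomial in [A] that takes the value a^(1/4) at every eigenvalue a of
   [A]; its square is the positive semidefinite square root of [A]. *)
Lemma pdmx_fourth_root_gen n (A : 'M[R]_n.+1) : pdmx A ->
  exists t : {poly R}, horner_mx A (t ^+ 4) = A.
Proof.
move=> pdA; have [P [d [Pu AE]]] := symmetric_diagonalization (proj1 pdA).
have dgt0 i : 0 < d 0 i.
  apply: (real_eigenvalue_pdmx pdA).
  rewrite eigenvalue_root_char -(fmorph_root toC) map_char_poly.
  rewrite -eigenvalue_root_char.
  by have := diagonalized_eigenvalue Pu AE i; rewrite mxE.
have [t tE] :=
  poly_interpolation (fun x => Num.sqrt (Num.sqrt x)) (codom (d 0)).
exists t; have tE4 i : (t ^+ 4).[d 0 i] = d 0 i.
  rewrite horner_exp tE ?codom_f// -[4%N]/(2 * 2)%N exprM.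
  by rewrite !sqr_sqrtr ?sqrtr_ge0 ?(ltW (dgt0 i)).
(* The embedding [toC] is injective, so the identity may be checked over [C], where [A] is
   diagonalized. *)
suff E : map_mx toC (horner_mx A (t ^+ 4)) = map_mx toC A.
  apply/matrixP => i j; have /matrixP/(_ i j) := E; rewrite !mxE.
  exact: fmorph_inj.
rewrite map_horner_mx; apply: (horner_mx_fixed Pu AE) => i.
by rewrite mxE horner_map/= tE4.
Qed.

End ComplexDiagonalization.

Lemma pdmx_fourth_root n (A : 'M[R]_n.+1) : pdmx A ->
  exists t : {poly R}, horner_mx A (t ^+ 4) = A.
Proof.
apply: (@pdmx_fourth_root_gen (complex R) (real_complex R) (@complex.Re R)) => x.
- by rewrite complex_real.
- exact: (@RRe_real R).
Qed.

(** With t(A)^4 = A, the square root is t(A)^2. A polynomial in a symmetric matrix is symmetric, so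
    t(A)^2 is t(A)^T t(A) and hence positive semidefinite. *)
Lemma pdmx_sqrt_ex n (A : 'M[R]_n) : pdmx A ->
  exists Y : 'M[R]_n, psdmx Y /\ Y *m Y = A.
Proof.
case: n A => [|n] A pdA.
  exists 0; split; last by rewrite !flatmx0; apply/matrixP => -[].
  by split=> [|v]; rewrite ?trmx0// mulmx0 mul0mx mxE.
have [t tA] := pdmx_fourth_root pdA.
have sym (p : {poly R}) : (horner_mx A p)^T = horner_mx A p.
  rewrite -[p]coefK poly_def raddf_sum raddf_sum/=; apply: eq_bigr => i _.
  rewrite -!mul_polyC !rmorphM/= horner_mx_C !rmorphXn/= horner_mx_X.
  rewrite -mulmxE trmx_mul tr_scalar_mx scalar_mxC; congr (_ *m _).
  elim: (nat_of_ord i) => [|j IH]; first by rewrite !expr0 trmx1.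
  by rewrite exprS -mulmxE trmx_mul IH (proj1 pdA) mulmxE -exprSr exprS.
exists (horner_mx A (t ^+ 2)); split; last by rewrite mulmxE -rmorphM -exprD.
split=> // v; rewrite expr2 rmorphM/= -mulmxE -{1}(sym t) mulmxA -trmx_mul.
by rewrite -mulmxA dot_ge0.
Qed.

Lemma sqrtmxP n (A : 'M[R]_n) : pdmx A ->
  psdmx (sqrtmx A) /\ sqrtmx A *m sqrtmx A = A.
Proof.
move=> /pdmx_sqrt_ex[Y YA]; rewrite /sqrtmx.
by case: xgetP => [//|/(_ Y)].
Qed.

(** For the root Y, (Y + I)(Y - I) = 0, and Y + I is positive definite, hence invertible. *)
Lemma sqrtmx1 n : sqrtmx (1%:M : 'M[R]_n) = 1%:M.
Proof.
have pd1 : pdmx (1%:M : 'M[R]_n).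
  split=> [|v v0]; first by rewrite trmx1.
  rewrite mulmx1 lt_neqAle dot_ge0 andbT eq_sym.
  by apply/eqP => /dot_eq0 /eqP; rewrite (negbTE v0).
have [[Yt Yp] YY] := sqrtmxP pd1; set Y := sqrtmx _ in Yt Yp YY *.
have /pdmx_unit Yu : pdmx (Y + 1%:M).
  split=> [|v v0]; first by rewrite raddfD/= Yt trmx1.
  rewrite mulmxDr mulmxDl mxE (lt_le_trans ((proj2 pd1) v v0))//.
  by rewrite lerDr Yp.
apply/eqP; rewrite -subr_eq0; apply/eqP.
apply: (can_inj (mulKmx Yu)); rewrite mulmx0 mulmxDl mulmxBr YY mul1mx mulmx1.
by rewrite addrC subrKA subrr.
Qed.

End MatrixSquareRoot.

(** * Linear matrix inequalities *)

Section DotProduct.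
Context {R : realType}.

Definition dot n (u v : 'cV[R]_n) : R := (u^T *m v) 0 0.

Lemma dotC n (u v : 'cV[R]_n) : dot u v = dot v u.
Proof. by rewrite /dot -[u^T *m v]trmxK trmx_mul trmxK mxE. Qed.

Lemma dotDr n (u v w : 'cV[R]_n) : dot u (v + w) = dot u v + dot u w.
Proof. by rewrite /dot mulmxDr mxE. Qed.

Lemma dotZr n (u v : 'cV[R]_n) a : dot u (a *: v) = a * dot u v.
Proof. by rewrite /dot -scalemxAr mxE. Qed.

Lemma dotNr n (u v : 'cV[R]_n) : dot u (- v) = - dot u v.
Proof. by rewrite /dot mulmxN mxE. Qed.

Lemma dotDl n (u v w : 'cV[R]_n) : dot (v + w) u = dot v u + dot w u.
Proof. by rewrite !(dotC _ u) dotDr. Qed.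

Lemma dotZl n (u v : 'cV[R]_n) a : dot (a *: v) u = a * dot v u.
Proof. by rewrite !(dotC _ u) dotZr. Qed.

Lemma dotNl n (u v : 'cV[R]_n) : dot (- v) u = - dot v u.
Proof. by rewrite !(dotC _ u) dotNr. Qed.

Lemma dot_mull n p (X : 'M[R]_(n, p)) (u : 'cV[R]_n) v :
  dot u (X *m v) = dot (X^T *m u) v.
Proof. by rewrite /dot trmx_mul trmxK mulmxA. Qed.

Lemma dotvv_ge0 n (v : 'cV[R]_n) : 0 <= dot v v.
Proof. exact: dot_ge0. Qed.

Lemma quadE n p (X : 'M[R]_(n, p)) u v : (u^T *m X *m v) 0 0 = dot u (X *m v).
Proof. by rewrite /dot mulmxA. Qed.

(** Cauchy-Schwarz: the squared norm of (v.v) u - (u.v) v equals v.v times the difference of the two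
    sides. *)
Lemma dot_sqr_le n (u v : 'cV[R]_n) : dot u v ^+ 2 <= dot u u * dot v v.
Proof.
have := dotvv_ge0 (dot v v *: u - dot u v *: v).
rewrite !(dotDl, dotDr, dotNl, dotNr, dotZl, dotZr) (dotC v u) => h.
have [v0|v0] := eqVneq (dot v v) 0.
  by rewrite v0 (dot_eq0 v0) {1}/dot mulmx0 mxE expr0n/= mulr0.
have vpos : 0 < dot v v by rewrite lt_neqAle eq_sym v0 dotvv_ge0.
rewrite -subr_ge0 -(pmulr_rge0 _ vpos); apply: le_trans h _.
by rewrite le_eqVlt; apply/orP; left; apply/eqP; ring.
Qed.

Lemma dot_enorm n (v : 'cV[R]_n) : dot v v = enorm v ^+ 2.
Proof.
rewrite /enorm sqr_sqrtr; last by apply: sumr_ge0 => i _; apply: sqr_ge0.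
by rewrite /dot dotE; apply: eq_bigr => i _; rewrite expr2.
Qed.

Lemma symblock3_quad p q r (X11 : 'M[R]_p) (X21 : 'M[R]_(q, p)) (X22 : 'M[R]_q)
    (X31 : 'M[R]_(r, p)) (X32 : 'M[R]_(r, q)) (X33 : 'M[R]_r) a b c :
  let v := col_mx (col_mx a b) c in
  dot v (symblock3 X11 X21 X22 X31 X32 X33 *m v) =
  dot a (X11 *m a) + dot b (X22 *m b) + dot c (X33 *m c)
  + 2 * (dot b (X21 *m a) + dot c (X31 *m a) + dot c (X32 *m b)).
Proof.
rewrite /= /symblock3 /dot !tr_col_mx !mul_block_col !mul_col_mx mul_row_col.
have add00 (M N : 'M[R]_1) : (M + N) 0 0 = M 0 0 + N 0 0 by rewrite mxE.
rewrite add_col_mx mul_row_col mul_row_col !mulmxDr !add00.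
have tr k l (X : 'M[R]_(k, l)) (y : 'cV[R]_l) (z : 'cV[R]_k) :
    (y^T *m (X^T *m z)) 0 0 = (z^T *m (X *m y)) 0 0.
  by rewrite -[LHS]/(dot _ _) dot_mull trmxK dotC.
by rewrite !tr; ring.
Qed.

End DotProduct.

Section LinearMatrixInequality.
Context {R : realType}.

Lemma psdmx_dot n (X : 'M[R]_n) v : psdmx X -> 0 <= dot v (X *m v).
Proof. by move=> [_ /(_ v)]; rewrite quadE. Qed.

Lemma Ibar_shift n L (A : 'M[R]_L) (B zeta : 'M[R]_(L, n)) : pdmx A ->
  B^T *m invmx A *m B + B^T *m zeta + zeta^T *m B + zeta^T *m A *m zeta =
  (zeta + invmx A *m B)^T *m A *m (zeta + invmx A *m B).
Proof.
move=> pdA; have Au := pdmx_unit pdA; have [At _] := pdA.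
have -> : (zeta + invmx A *m B)^T = zeta^T + B^T *m invmx A.
  by rewrite linearD/= trmx_mul trmx_inv At.
rewrite !mulmxDl !mulmxDr -(mulmxA B^T (invmx A) A) mulVmx// mulmx1.
rewrite -(mulmxA zeta^T A (invmx A *m B)) (mulmxA A) mulmxV// mul1mx !mulmxA.
rewrite addrC -[RHS]addrA; congr (_ + _); rewrite addrC; congr (_ + _).
exact: addrC.
Qed.

Lemma Ibar_dissipation n L (A : 'M[R]_L) (B zeta : 'M[R]_(L, n))
    (g : 'rV[R]_n) (l : 'cV[R]_L) (a lam : R) :
  pdmx A -> 0 < lam ->
  loewner_le (B^T *m invmx A *m B + B^T *m zeta
              + zeta^T *m B + zeta^T *m A *m zeta) 1%:M ->
  (forall v, dot v (symblock3
       (a%:M + g *m (- (invmx A *m B))^T *m l)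
       (sqrtmx 1%:M *m g^T)   (- (2 * lam)%:M)
       (lam *: (invmx (sqrtmx A) *m l)) 0 (- (2 * lam)%:M) *m v) <= 0) ->
  a + (g *m zeta^T *m l) 0 0 <= 0.
Proof.
move=> pdA lam0 + lmi; rewrite Ibar_shift//.
set D := zeta + _ => ID.
have [[St _] SS] := sqrtmxP pdA; set S := sqrtmx A in St SS lmi *.
have Su : S \in unitmx.
  by have := pdmx_unit pdA; rewrite -SS unitmx_mul andbb.
(* The factors S and S^-1 cancel in u.l', which is therefore g D^T l, while D^T A D <= I bounds |u|
   by |g|. *)
pose l' := invmx S *m l; pose u := S *m (D *m g^T).
have ul : (g *m D^T *m l) 0 0 = dot u l'.
  rewrite /u dotC dot_mull St /l' mulKVmx// dotC /dot.
  by rewrite trmx_mul trmxK.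
have uu : dot u u <= dot g^T g^T.
  have := psdmx_dot g^T ID; rewrite mulmxBl mul1mx dotDr dotNr subr_ge0.
  suff -> : dot g^T (D^T *m A *m D *m g^T) = dot u u by [].
  rewrite /u [RHS]dot_mull St mulmxA SS -!mulmxA [LHS]dot_mull trmxK.
  exact: dotC.
(* With first component 1, these second and third components maximize the quadratic form; they
   contribute |g|^2 / (2 lam) and lam |l'|^2 / 2. *)
have := lmi (col_mx (col_mx 1%:M ((2 * lam)^-1 *: g^T)) (2^-1 *: l')).
have dot1 (X : 'M[R]_1) : dot 1%:M (X *m 1%:M) = X 0 0.
  by rewrite /dot trmx1 mul1mx mulmx1.
have dots k c (v : 'cV[R]_k) : dot v (- c%:M *m v) = - (c * dot v v).
  by rewrite mulNmx mul_scalar_mx dotNr dotZr.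
rewrite symblock3_quad sqrtmx1 dot1 !dots mul1mx !mulmx1 mul0mx -/l'.
have -> k (v : 'cV[R]_k) : dot v 0 = 0 by rewrite /dot mulmx0 mxE.
have -> : (a%:M + g *m (- (invmx A *m B))^T *m l) 0 0 =
    a + (g *m (zeta^T - D^T) *m l) 0 0.
  by rewrite mxE mxE eqxx mulr1n -linearB/= /D opprD addNKr.
rewrite !(dotZl, dotZr) mulmxBr mulmxBl mxE [X in _ + (_ + X)]mxE ul.
have := dotvv_ge0 (u - lam *: l').
rewrite !(dotDl, dotDr, dotNl, dotNr, dotZl, dotZr) (dotC l' u).
set gz := (_ *m _) 0 0.
set U := dot u u in uu *; set G := dot g^T g^T in uu *.
set P := dot u l'; set Q := dot l' l' => h1 h2.
have lamN0 : lam != 0 by rewrite gt_eqF.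
(* Young's inequality, from |u - lam l'|^2 >= 0 and |u| <= |g|, divided by 2 lam. *)
have h3 : P <= (2 * lam)^-1 * G + 2^-1 * lam * Q.
  rewrite -(ler_pM2l (mulr_gt0 (ltr0Sn R 1) lam0)).
  have -> : 2 * lam * ((2 * lam)^-1 * G + 2^-1 * lam * Q) = G + lam * (lam * Q).
    by field.
  by lra.
move: h2; match goal with |- is_true (?e <= 0) -> _ =>
  have -> : e = a + gz - P + ((2 * lam)^-1 * G + 2^-1 * lam * Q) by field
end; lra.
Qed.

Lemma dot_outer n p (v : 'cV[R]_n) (x : 'cV[R]_n) (y w : 'cV[R]_p) :
  dot v (x *m y^T *m w) = dot v x * dot y w.
Proof.
rewrite /dot -mulmxA mulmxA [in LHS](mx11_scalar (y^T *m w)) mul_mx_scalar.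
by rewrite mxE mulrC.
Qed.

Lemma dot_sum n p (I : finType) (tau : I -> R) (X : I -> 'M[R]_(n, p)) v w :
  dot v ((\sum_i tau i *: X i) *m w) = \sum_i tau i * dot v (X i *m w).
Proof.
rewrite mulmx_suml /dot mulmx_sumr summxE; apply: eq_bigr => i _.
by rewrite -scalemxAl -scalemxAr mxE.
Qed.

(* The S-procedure: the test vector [(v, zeta v, A^-1 B v)] turns the LMI of
   the program into a combination of the data constraints on [zeta]. *)
Lemma opt_feasible_Ibar n m N M T (Z : 'cV[mpolynomial R n]_N)
    (W : 'M[mpolynomial R n]_(M, m)) (us : 'I_T -> 'cV[R]_m)
    (xs xdots : 'I_T -> 'cV[R]_n) (delta : R) A B tau (E : 'M[R]_(n, N + M)) :
  (forall i, enorm (xdots i - E *m regressor Z W (xs i) (us i)) ^+ 2 <= delta) ->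
  opt_feasible Z W us xs xdots delta A B tau -> Ibar A B E.
Proof.
move=> noise [pdA tau0 lmi]; exists E^T; last by rewrite trmxK.
have Au := pdmx_unit pdA; have [At _] := pdA.
split=> [|v].
  rewrite Ibar_shift// linearB/= trmx1; congr (_ - _).
  by rewrite !trmx_mul !trmxK At mulmxA.
rewrite quadE trmxK.
pose l i := regressor Z W (xs i) (us i); pose z := E^T *m v.
have := psdmx_dot (col_mx (col_mx v z) (invmx A *m B *m v)) lmi.
rewrite sub0r mulNmx dotNr oppr_ge0 symblock3_quad mul0mx.
have -> k (w : 'cV[R]_k) : dot w 0 = 0 by rewrite /dot mulmx0 mxE.
rewrite !mulmxBl !mulNmx !mul1mx !dotDr !dotNr !dot_sum.
have -> : A *m (invmx A *m B *m v) = B *m v by rewrite -mulmxA mulKVmx.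
rewrite !mulmxDl !dotDr.
have -> : B^T *m invmx A *m B *m v = B^T *m (invmx A *m B *m v).
  by rewrite !mulmxA.
rewrite (dot_mull B^T) trmxK [dot (B *m v) _]dotC.
rewrite -(mulmxA B^T) -/z [dot v (B^T *m z)]dot_mull trmxK [dot (B *m v) z]dotC.
rewrite -(mulmxA E B v) (dot_mull E) -/z -(mulmxA (E *m A)) -/z -(mulmxA E A).
rewrite (dot_mull E) -/z.
set S1 := \sum_i _; set S2 := \sum_i _; set S3 := \sum_i _.
(* What the LMI leaves after substitution is the inequality defining [Ibar], up to the terms
   weighted by [tau]. *)
suff : S1 + S2 + 2 * S3 <= 0 by lra.
rewrite /S1 /S2 /S3 mulr_sumr -!big_split/=; apply: sumr_le0 => i _.
rewrite mulrCA -!mulrDr mulr_ge0_le0//.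
rewrite /dataC /dataA /dataB mulmxBl dotDr dotNr mul_scalar_mx dotZr mulNmx dotNr.
rewrite !dot_outer -/(l i).
have -> : dot z (l i) = dot v (E *m l i) by rewrite dot_mull.
(* The i-th summand is tau_i times (v.(xdot_i - E l_i))^2 - delta |v|^2, nonpositive by
   Cauchy-Schwarz and the noise bound. *)
have := dot_sqr_le v (xdots i - E *m l i); rewrite dotDr dotNr [dot (_ - _) _]dot_enorm.
have := dotvv_ge0 v; have := noise i; rewrite -/(l i).
rewrite (dotC (l i)) (dotC (xdots i) v).
have -> : dot z (l i) = dot v (E *m l i) by rewrite dot_mull.
set e := enorm _ ^+ 2; set p := dot v (xdots i); set q := dot v (E *m l i).
by move=> ed v0 h; have h1 := ler_wpM2l v0 ed; rewrite !expr2 in h *; lra.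
Qed.

End LinearMatrixInequality.

(** * Comparison functions and Lyapunov decay *)

Section ComparisonFunctions.
Context {R : realType}.
Implicit Types (g h : R -> R) (r s : R).

(** Class K with continuity on all of R, so that compositions and sums need no restricted
    domains. *)
Definition Kfun g := [/\ continuous g,
  {in `[0, +oo[ &, {homo g : r s / r < s}} & g 0 = 0].

Lemma Kfun_class_K g : Kfun g -> class_K g.
Proof. by move=> [gc gi g0]; split=> //; exact: continuous_subspaceT. Qed.

Lemma Kfun_lt g r s : Kfun g -> 0 <= r -> r < s -> g r < g s.
Proof.
move=> [_ gi _] r0 rs; apply: gi; rewrite ?in_itv/= ?andbT//.
exact: le_trans r0 (ltW rs).
Qed.

Lemma Kfun_le g r s : Kfun g -> 0 <= r -> r <= s -> g r <= g s.
Proof.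
move=> gK r0; rewrite le_eqVlt => /predU1P[->//|rs].
by rewrite ltW// Kfun_lt.
Qed.

Lemma Kfun_ge0 g r : Kfun g -> 0 <= r -> 0 <= g r.
Proof. by move=> gK r0; case: (gK) => _ _ <-; exact: Kfun_le. Qed.

Lemma Kfun_ltV g r s : Kfun g -> 0 <= s -> g r < g s -> r < s.
Proof.
move=> gK s0; apply: contraTT; rewrite -!leNgt => sr; exact: Kfun_le.
Qed.

Lemma Kfun_comp g h : Kfun g -> Kfun h -> Kfun (g \o h).
Proof.
move=> gK hK; have [gc _ g0] := gK; have [hc _ h0] := hK; split.
- by move=> x; apply: continuous_comp; [exact: hc | exact: gc].
- move=> r s; rewrite !in_itv/= !andbT => r0 s0 rs.
  by apply: Kfun_lt => //; [exact: Kfun_ge0 | exact: Kfun_lt].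
- by rewrite /= h0.
Qed.

Lemma Kfun_add g h : Kfun g -> Kfun h -> Kfun (fun r => g r + h r).
Proof.
move=> [gc gi g0] [hc hi h0]; split.
- by move=> x; apply: cvgD; [exact: gc | exact: hc].
- by move=> r s r0 s0 rs; apply: ltrD; [exact: gi | exact: hi].
- by rewrite g0 h0 addr0.
Qed.

Lemma Kfun_scale (c : R) : 0 < c -> Kfun (fun r => c * r).
Proof.
move=> c0; split; last by rewrite mulr0.
- by move=> x; apply: cvgM; [exact: cvg_cst | exact: cvg_id].
- by move=> r s _ _ rs; rewrite ltr_pM2l.
Qed.

Lemma Kfun_sqrt : Kfun (@Num.sqrt R).
Proof.
split; [exact: sqrt_continuous | | by rewrite sqrtr0].
move=> r s; rewrite !in_itv/= !andbT => r0 s0 rs.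
by rewrite ltr_sqrt// (le_lt_trans r0).
Qed.

Lemma Kfun_iter k g : Kfun g -> Kfun (fun r => iter k g r).
Proof.
move=> gK; elim: k => [|k IH] /=.
  by split=> //; [move=> x; exact: cvg_id].
exact: Kfun_comp gK IH.
Qed.

Lemma iter_sqrtK k (u : R) : 0 <= u -> iter k Num.sqrt u ^+ (2 ^ k) = u.
Proof.
elim: k => [|k IH] u0 /=; first by rewrite expr1.
by rewrite expnS exprM sqr_sqrtr ?IH// (Kfun_ge0 (Kfun_iter k Kfun_sqrt)).
Qed.

Lemma even_comparison_ord (mu : R) (a : {poly R}) : even_comparison mu a ->
  exists (N : nat) (c : 'I_N -> R), [/\ forall i, 0 <= c i,
    mu <= \sum_i c i & forall r, a.[r] = \sum_i c i * (r ^+ 2) ^+ i.+1].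
Proof.
move=> [N [c [_ c0 cmu aE]]]; exists N, (fun i : 'I_N => c i.+1); split.
- by move=> i; apply: c0; rewrite /= ltn_ord.
- by rewrite -(big_mkord xpredT (fun i => c i.+1)) -(big_add1 _ _ 0 N.+1 xpredT c).
- move=> r; rewrite aE big_add1 big_mkord; apply: eq_bigr => i _.
  by rewrite exprM.
Qed.

Lemma even_comparison_Kfun (mu : R) (a : {poly R}) : 0 < mu ->
  even_comparison mu a -> Kfun (horner a).
Proof.
move=> mu0 /even_comparison_ord[N [c [c0 cmu aE]]]; split.
- exact: continuous_horner.
- move=> r s; rewrite !in_itv/= !andbT => r0 s0 rs.
  have pw i : (r ^+ 2) ^+ i.+1 < (s ^+ 2) ^+ i.+1.
    by rewrite -!exprM ltrXn2r.
  rewrite -subr_gt0 !aE -sumrB.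
  have ge0 (i : 'I_N) : 0 <= c i * (s ^+ 2) ^+ i.+1 - c i * (r ^+ 2) ^+ i.+1.
    by rewrite -mulrBr mulr_ge0// subr_ge0 ltW.
  (* If the difference vanished, every c_i would be zero, against their sum being at least mu >
     0. *)
  rewrite lt_neqAle sumr_ge0 ?andbT// eq_sym psumr_eq0//.
  apply/negP => /allP h; have := lt_le_trans mu0 cmu.
  rewrite big1 ?ltxx// => i _; apply/eqP; have := h i (mem_index_enum i).
  by rewrite /= -mulrBr mulf_eq0 subr_eq0 (gt_eqF (pw i)) orbF.
- by rewrite aE big1// => i _; rewrite expr0n/= expr0n/= mulr0.
Qed.

(** With q = u / mu and b(u)^2 = s = q + q^(1/2^N), every power s^(i+1) with i < N is at least q;
    weighting by the c_i, whose sum is at least mu, gives a(b(u)) >= u. *)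
Lemma even_comparison_inverse (mu : R) (a : {poly R}) : 0 < mu ->
  even_comparison mu a ->
  exists2 b : R -> R, Kfun b & forall u, 0 <= u -> u <= a.[b u].
Proof.
move=> mu0 /even_comparison_ord[N [c [c0 cmu aE]]].
pose root u : R := iter N Num.sqrt (mu^-1 * u).
have muV0 : 0 < mu^-1 by rewrite invr_gt0.
have rootK : Kfun root.
  exact: Kfun_comp (Kfun_iter N Kfun_sqrt) (Kfun_scale muV0).
exists (fun u => Num.sqrt (mu^-1 * u + root u)).
  exact: Kfun_comp Kfun_sqrt (Kfun_add (Kfun_scale muV0) rootK).
move=> u u0; rewrite aE.
have u'0 : 0 <= mu^-1 * u by rewrite mulr_ge0// ltW.
have r0 : 0 <= root u by exact: Kfun_ge0.
rewrite sqr_sqrtr ?addr_ge0//; set s := _ + _.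
have s0 : 0 <= s by rewrite addr_ge0.
have us (i : 'I_N) : mu^-1 * u <= s ^+ i.+1.
  (* For s >= 1 the summand q of s suffices. For s < 1 powers decrease with the exponent, and i + 1
     <= 2^N reduces the claim to s^(2^N) >= q, which the root summand gives. *)
  have [s1|s1] := leP 1 s.
    by apply: (@le_trans _ _ s); [rewrite lerDl | rewrite ler_eXnr].
  apply: (@le_trans _ _ (s ^+ (2 ^ N))).
    by rewrite -{1}(iter_sqrtK N u'0) lerXn2r// lerDr.
  rewrite ler_wiXn2l// ?ltW//.
  exact: (leq_trans (ltn_ord i) (ltnW (ltn_expl N (isT : 1 < 2)%N))).
apply: (@le_trans _ _ (\sum_i c i * (mu^-1 * u))); last first.
  by apply: ler_sum => i _; rewrite ler_wpM2l.
by rewrite -mulr_suml mulrA ler_peMl// ler_pdivlMr// mul1r.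
Qed.

End ComparisonFunctions.

(** * Monotonicity from derivative bounds that hold off a finite set *)

Section MonotonicityOffFiniteSets.
Context {R : realType}.
Implicit Types (f : R -> R) (D : seq R).

(** Induction on the exceptional points: split the interval at each one inside it and apply the mean
    value theorem to the pieces. *)
Lemma derive_le_off_finite f D (K a b : R) : a <= b -> continuous f ->
  (forall t, a < t < b -> t \notin D -> derivable f t 1 /\ 'D_1 f t <= K) ->
  f b - f a <= K * (b - a).
Proof.
move=> + cf; elim: D a b => [|d D IH] a b ab df.
  have [->|ab'] := eqVneq a b; first by rewrite !subrr mulr0.
  have ltab : a < b by rewrite lt_neqAle ab'.
  have [|c] := @MVT R f (fun t => 'D_1 f t) a b ltab _ (continuous_subspaceT cf).
    by move=> t; rewrite in_itv/= => /df[]// ft _; exact: DeriveDef.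
  by rewrite in_itv/= => /df[]// _ cK ->; rewrite ler_wpM2r// subr_ge0.
have [/andP[ad db]|dab] := boolP (a < d < b); last first.
  apply: IH => // t tab tD; apply: df => //; rewrite inE negb_or tD andbT.
  by apply: contraNneq dab => <-.
rewrite -(subrKA (f d)) -(subrKA d b) mulrDr lerD//; apply: IH; rewrite ?ltW//.
  move=> t /andP[dt tb] tD; apply: df; first by rewrite (lt_trans ad dt).
  by rewrite inE negb_or tD andbT gt_eqF.
move=> t /andP[at_ td] tD; apply: df; first by rewrite at_ (lt_trans td db).
by rewrite inE negb_or tD andbT lt_eqF.
Qed.

Lemma first_hit f (a b r : R) : a <= b -> continuous f -> f a < r -> r <= f b ->
  exists2 t, a < t <= b & r <= f t /\ forall s, a <= s < t -> f s < r.
Proof.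
move=> ab cf far rfb.
pose S := [set s | a <= s <= b /\ r <= f s].
have Sb : S b by split=> //; rewrite ab lexx.
have Sinf : has_inf S by split; [exists b | exists a => s [/andP[]]].
pose t := inf S.
have at_ : a <= t by apply: lb_le_inf; [exists b | move=> s [/andP[]]].
have tb : t <= b by apply: ge_inf => //; case: Sinf.
have before s : a <= s < t -> f s < r.
  move=> /andP[as_ st]; rewrite ltNge; apply/negP => rs.
  suff : t <= s by rewrite leNgt st.
  apply: ge_inf; first by case: Sinf.
  by split=> //; rewrite as_ (le_trans (ltW st)).
have rt : r <= f t.
  rewrite leNgt; apply/negP => ft.
  have /nbhs_ballP[e/= e0 te] : \forall s \near t, f s < r.
    by apply: (cvgr_lt _ (cf t)).
  have [s [sab rs] ste] := inf_adherent e0 Sinf.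
  have ts : t <= s by apply: ge_inf => //; case: Sinf.
  have := te s; rewrite /ball/= distrC ger0_norm ?subr_ge0// ltrBlDl.
  by move=> /(_ ste); rewrite ltNge rs.
exists t => //; rewrite tb andbT lt_neqAle at_ andbT.
by apply: contraTneq rt => <-; rewrite -ltNge.
Qed.

(** If f a < f b, consider the last time at which f is at most max(f a, m). After it f exceeds m, so
    it cannot increase up to f b. *)
Lemma derive_barrier f D (m a b : R) : a <= b -> continuous f ->
  (forall t, a < t < b -> t \notin D -> m < f t ->
     derivable f t 1 /\ 'D_1 f t <= 0) ->
  m < f b -> f b <= f a.
Proof.
move=> ab cf df mfb; rewrite leNgt; apply/negP => fab.
pose r := Num.max (f a) m.
have rfb : r < f b by rewrite /r gt_max fab mfb.
(* Reversing both time and sign turns the last time below [r] into a first hitting time. *)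
have ch : continuous (fun s => - f (a + b - s)).
  move=> s; apply: continuousN; apply: continuous_comp; last exact: cf.
  by apply: continuousB; [exact: cst_continuous | exact: cvg_id].
have [||s /andP[as_ sb] [rs before]] := @first_hit _ a b (- r) ab ch.
- by rewrite addrAC subrr add0r ltrN2.
- by rewrite addrK lerN2 /r le_max lexx.
rewrite lerN2 in rs; set t := a + b - s in rs.
have tb : t < b by rewrite /t; lra.
have := @derive_le_off_finite f D 0 t b (ltW tb) cf.
rewrite mul0r subr_le0 => /(_ _)/wrap[u /andP[tu ub] uD|fbt]; last first.
  by have := le_lt_trans (le_trans fbt rs) rfb; rewrite ltxx.
apply: df => //; first by rewrite ub andbT /t in tu *; lra.
have := before (a + b - u).
have -> : a + b - (a + b - u) = u by ring.
rewrite ltrN2 => ru; apply: le_lt_trans (ru _); first by rewrite /r le_max lexx orbT.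
by apply/andP; split; rewrite /t in tu; lra.
Qed.

(* [y] is the value of the Lyapunov function and [r] the norm of the state
   along a trajectory; [c] bounds the supply rate of the input. *)
Lemma lyapunov_decay (y r : R -> R) D (T c : R) (a1 a2 a3 b1 b3 : R -> R) :
  Kfun a1 -> Kfun a2 -> Kfun a3 -> Kfun b1 -> Kfun b3 ->
  (forall u, 0 <= u -> u <= a1 (b1 u)) -> (forall u, 0 <= u -> u <= a3 (b3 u)) ->
  0 <= T -> 0 <= c -> continuous y -> (forall t, 0 <= r t) ->
  (forall t, a1 (r t) <= y t <= a2 (r t)) ->
  (forall t, 0 < t < T -> t \notin D ->
     derivable y t 1 /\ 'D_1 y t <= - a3 (r t) + c) ->
  let z : R := a2 (r 0) / (1 + T) in
  is_true (r T <= b1 (a2 (b3 (2 * z))) + b1 z + b1 (a2 (b3 (2 * c)))).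
Proof.
move=> a1K a2K a3K b1K b3K ab1 ab3 T0 c0 cy r0 yr dy z.
have T1 : 0 < 1 + T by rewrite ltr_pwDl.
have z0 : 0 <= z by rewrite divr_ge0 ?(ltW T1)// (Kfun_ge0 a2K).
have B3 u : 0 <= u -> 0 <= b3 (2 * u).
  by move=> u0; rewrite (Kfun_ge0 b3K)// mulr_ge0.
have A2 u : 0 <= u -> 0 <= a2 (b3 (2 * u)) by move=> /B3; exact: Kfun_ge0.
have B1 u : 0 <= u -> 0 <= b1 u by exact: Kfun_ge0.
rewrite leNgt; apply/negP => big.
have yT u : 0 <= u -> b1 u < r T -> u < y T.
  move=> u0 ur; apply: le_lt_trans (ab1 _ u0) _.
  by apply: lt_le_trans (Kfun_lt a1K (B1 _ u0) ur) _; case/andP: (yr T).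
have zc0 : 0 <= Num.max z c by rewrite le_max z0.
(* Above this level [a3 (r t)] exceeds 2 max(z, c): half of it absorbs the supply c, the other half
   leaves a decrease at rate z. *)
pose m := a2 (b3 (2 * Num.max z c)).
have bz := B1 _ z0; have bbz := B1 _ (A2 _ z0); have bbc := B1 _ (A2 _ c0).
(* By the case distinction on the maximum, [b1 m] is one of the three nonnegative terms that [r T]
   exceeds in sum. *)
have myT : m < y T.
  by apply: yT; [exact: A2 | rewrite /m; case: (leP z c) => _; lra].
have zyT : z < y T by apply: yT => //; lra.
have rate t : m < y t -> 2 * Num.max z c < a3 (r t).
  move=> my; have : m < a2 (r t) by apply: lt_le_trans my _; case/andP: (yr t).
  move=> /(Kfun_ltV a2K (r0 t)) br; apply: le_lt_trans (Kfun_lt a3K (B3 _ zc0) br).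
  by apply: ab3; rewrite mulr_ge0.
have max_z : z <= Num.max z c by rewrite le_max lexx.
have max_c : c <= Num.max z c by rewrite le_max lexx orbT.
(* The barrier argument propagates y T > m back to all earlier times. *)
have above t : 0 <= t <= T -> m < y t.
  move=> /andP[t0 tT]; apply: (@lt_le_trans _ _ (y T)) => //.
  apply: (@derive_barrier y D m t T tT cy _ myT) => s /andP[ts sT] sD my.
  have [|ds dsle] := dy s _ sD; first by rewrite (le_lt_trans t0 ts).
  by split=> //; apply: le_trans dsle _; have := rate _ my; lra.
have := @derive_le_off_finite y D (- z) 0 T T0 cy.
rewrite subr0 => /(_ _)/wrap[t /andP[t0 tT] tD|decr].
  have [|dt dtle] := dy t _ tD; first by rewrite t0.
  split=> //; apply: le_trans dtle _.
  have : 2 * Num.max z c < a3 (r t) by apply/rate/above; rewrite !ltW.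
  by lra.
(* Now y T <= a2 (r 0) - z T = z, contradicting z < y T; this is what fixes the choice of z. *)
have : z * (1 + T) = a2 (r 0) by rewrite divfK// gt_eqF.
by have /andP[_] := yr 0; lra.
Qed.

End MonotonicityOffFiniteSets.

(** * An explicit family of class KL functions *)

Section KLFunction.
Context {R : realType}.

(** The absolute value keeps the denominator at least 1 for every real s, so joint continuity holds
    on the whole plane. *)
Lemma Kfun_class_KL (g h : R -> R) : Kfun g -> Kfun h ->
  class_KL (fun r s => g (h r / (1 + `|s|))).
Proof.
move=> gK hK; have [gc _ g0] := gK; have [hc _ h0] := hK.
have pos (s : R) : 0 < 1 + `|s| by rewrite ltr_pwDl.
split.
- apply: continuous_subspaceT => -[r s].
  apply: (@continuous_comp _ _ _ (fun p : R * R => h p.1 / (1 + `|p.2|)) g);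
    last exact: gc.
  apply: continuousM.
    by apply: (@continuous_comp _ _ _ fst h); [exact: cvg_fst | exact: hc].
  apply: continuousV; first by rewrite gt_eqF/=.
  apply: continuousD; first exact: cst_continuous.
  by apply: cvg_norm; exact: cvg_snd.
- move=> s _; apply: Kfun_class_K.
  have sK : Kfun (fun r => (1 + `|s|)^-1 * r) by apply: Kfun_scale; rewrite invr_gt0.
  have := Kfun_comp gK (Kfun_comp sK hK); congr Kfun.
  by apply/funext => r /=; rewrite mulrC.
- move=> r r0 s t; rewrite !in_itv/= !andbT => s0 t0 ts.
  have hr0 := Kfun_ge0 hK r0.
  apply: (Kfun_le gK); first by rewrite divr_ge0// ltW.
  by rewrite ler_wpM2l// lef_pV2 ?posrE// lerD2l !ger0_norm.
- move=> r r0; rewrite -g0.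
  have hr0 := Kfun_ge0 hK r0.
  apply: (@cvg_comp _ _ _ (fun s : R => h r / (1 + `|s|)) g _ (nbhs (0 : R)));
    last exact: gc.
  apply/cvgrPdist_lt => e e0; near=> s.
  rewrite sub0r normrN ger0_norm; last by rewrite divr_ge0// ltW.
  rewrite ltr_pdivrMr//.
  have s1 : h r / e < s by near: s; apply: nbhs_pinfty_gt; rewrite num_real.
  rewrite ltr_pdivrMr// mulrC in s1.
  apply: lt_trans s1 _; rewrite ltr_pM2l//.
  by apply: (@le_lt_trans _ _ `|s|); [exact: ler_norm | rewrite ltrDr].
Unshelve. all: by end_near. Qed.

End KLFunction.

(** * Polynomial maps *)

Section PolynomialCalculus.
Context {R : realType}.

(** Monomials are products of powers of variables, so a property stable under the ring operations
    spreads from constants and variables to all polynomials. *)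
Lemma mpoly_ring_ind n (P : mpolynomial R n -> Prop) :
  (forall c, P (mpolyC n c)) -> (forall i, P (mpolyX R (mnm1 i))) ->
  (forall p q, P p -> P q -> P (p + q)) ->
  (forall p q, P p -> P q -> P (p * q)) -> forall p, P p.
Proof.
move=> PC PX PD PM; elim/mpolyind => [|c m p _ _ IH].
  by have := PC 0; rewrite mpolyC0.
apply: PD => //; rewrite -mul_mpolyC; apply: (PM) => //.
have P1 : P 1 by have := PC 1; rewrite mpolyC1.
rewrite mpolyXE_id; apply: big_ind => [//|p' q'|i _]; first exact: PM.
by elim: (m i) => [|k IHk]; rewrite ?expr0// exprS; apply: PM.
Qed.

Lemma mderivXU n (i j : 'I_n) : mderiv i (mpolyX R (mnm1 j)) = (i == j)%:R.
Proof.
rewrite mderivX mnm1E eq_sym; case: eqVneq => [->|]; last by rewrite scale0r.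
by rewrite -[X in mnm_sub X _]add0m addmK mpolyX0 scale1r.
Qed.

Lemma gradient_mul n (p q : mpolynomial R n) (x dx : 'cV[R]_n) :
  (gradient (p * q) x *m dx) 0 0 =
  peval x p * (gradient q x *m dx) 0 0 + peval x q * (gradient p x *m dx) 0 0.
Proof.
rewrite !mxE !mulr_sumr -big_split/=; apply: eq_bigr => i _.
by rewrite !mxE mderivM /peval mevalD !mevalM; ring.
Qed.

Lemma gradient_add n (p q : mpolynomial R n) (x : 'cV[R]_n) :
  gradient (p + q) x = gradient p x + gradient q x.
Proof. by apply/rowP => i; rewrite !mxE mderivD /peval mevalD. Qed.

Lemma is_derive_coord n (x : R -> 'cV[R]_n) (t : R) (dx : 'cV[R]_n) i :
  is_derive t 1 x dx -> is_derive t 1 (fun s => x s i 0) (dx i 0).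
Proof.
move=> [ex xE]; apply: DeriveDef; first by have /derivable_mxP := ex; exact.
by rewrite -xE derive_mx// mxE.
Qed.

Lemma is_derive_peval n (x : R -> 'cV[R]_n) (t : R) (dx : 'cV[R]_n)
    (p : mpolynomial R n) : is_derive t 1 x dx ->
  is_derive t 1 (fun s => peval (x s) p) ((gradient p (x t) *m dx) 0 0).
Proof.
move=> xd; elim/mpoly_ring_ind: p => [c|i|p q IHp IHq|p q IHp IHq].
- have -> : gradient (mpolyC n c) (x t) = 0.
    by apply/rowP => i; rewrite !mxE mderivC /peval meval0.
  rewrite mul0mx mxE (_ : (fun s => _) = cst c); first exact: is_derive_cst.
  by apply/funext => s; rewrite /peval mevalC.
- have -> : (gradient (mpolyX R (mnm1 i)) (x t) *m dx) 0 0 = dx i 0.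
    rewrite mxE (bigD1 i)//= big1 => [|j ji]; rewrite !mxE mderivXU.
      by rewrite eqxx /peval meval1 mul1r addr0.
    by rewrite (negbTE ji) /peval meval0 mul0r.
  rewrite (_ : (fun s => _) = (fun s => x s i 0)); first exact: is_derive_coord.
  by apply/funext => s; rewrite /peval mevalXU.
- rewrite gradient_add mulmxDl mxE.
  rewrite (_ : (fun s => _) = (fun s => peval (x s) p) + (fun s => peval (x s) q)).
    exact: is_deriveD.
  by apply/funext => s; rewrite /peval mevalD.
- rewrite gradient_mul.
  rewrite (_ : (fun s => _) = (fun s => peval (x s) p) * (fun s => peval (x s) q)).
    exact: is_deriveM.
  by apply/funext => s; rewrite /peval mevalM.
Qed.

(** Unlike global Lipschitz continuity this is stable under products, hence holds for polynomial
    maps; it yields local Lipschitz continuity and, after truncation, a global constant. *)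
Definition lip_on_balls (U V : normedModType R) (f : U -> V) :=
  forall r : R, exists2 L : R, 0 <= L & forall x y, `|x| <= r -> `|y| <= r ->
    `|f x - f y| <= L * `|x - y|.

Section Closure.
Variable U : normedModType R.
Implicit Types f g : U -> R.

Lemma lip_cst (c : R) : lip_on_balls (fun _ : U => c).
Proof. by move=> r; exists 0 => // x y _ _; rewrite subrr normr0 mul0r. Qed.

Lemma lip_add f g : lip_on_balls f -> lip_on_balls g ->
  lip_on_balls (fun x => f x + g x).
Proof.
move=> fl gl r; have [L L0 fL] := fl r; have [K K0 gK] := gl r.
exists (L + K) => [|x y xr yr]; first exact: addr_ge0.
rewrite opprD addrACA mulrDl (le_trans (ler_normD _ _))// lerD//.
  exact: fL.
exact: gK.
Qed.

Lemma lip_on_balls_bounded f (r : R) : lip_on_balls f ->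
  exists2 M : R, 0 <= M & forall x, `|x| <= r -> `|f x| <= M.
Proof.
move=> /(_ r)[L L0 fL]; exists (`|f 0| + L * `|r|) => [|x xr].
  by rewrite addr_ge0// mulr_ge0.
rewrite -[f x](subrK (f 0)) addrC (le_trans (ler_normD _ _))// lerD2l.
have r0 : 0 <= r by apply: le_trans xr.
apply: le_trans (fL _ _ xr _) _; first by rewrite normr0.
by rewrite subr0 ler_wpM2l// (le_trans xr)// ler_norm.
Qed.

Lemma lip_mul f g : lip_on_balls f -> lip_on_balls g ->
  lip_on_balls (fun x => f x * g x).
Proof.
move=> fl gl r; have [L L0 fL] := fl r; have [K K0 gK] := gl r.
have [A A0 fA] := lip_on_balls_bounded r fl.
have [B B0 gB] := lip_on_balls_bounded r gl.
exists (A * K + B * L) => [|x y xr yr]; first by rewrite addr_ge0// mulr_ge0.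
have -> : f x * g x - f y * g y = f x * (g x - g y) + g y * (f x - f y) by ring.
rewrite (le_trans (ler_normD _ _))// !normrM mulrDl -!mulrA.
by rewrite lerD// ler_pM ?fA ?gB ?gK ?fL.
Qed.

Lemma lip_sum (I : finType) (f : I -> U -> R) : (forall i, lip_on_balls (f i)) ->
  lip_on_balls (fun x => \sum_i f i x).
Proof.
move=> fl; elim: (index_enum I) => [|i s IH].
  rewrite (_ : (fun x => _) = fun=> 0); first exact: lip_cst.
  by apply/funext => x; rewrite big_nil.
rewrite (_ : (fun x => _) = fun x => f i x + \sum_(j <- s) f j x).
  exact: lip_add.
by apply/funext => x; rewrite big_cons.
Qed.

Lemma lip_peval n (a : U -> 'cV[R]_n) (p : mpolynomial R n) :
  (forall i, lip_on_balls (fun x => a x i 0)) ->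
  lip_on_balls (fun x => peval (a x) p).
Proof.
move=> al; elim/mpoly_ring_ind: p => [c|i|p q IHp IHq|p q IHp IHq].
- rewrite (_ : (fun x => _) = fun=> c); first exact: lip_cst.
  by apply/funext => x; rewrite /peval mevalC.
- rewrite (_ : (fun x => _) = fun x => a x i 0) //.
  by apply/funext => x; rewrite /peval mevalXU.
- rewrite (_ : (fun x => _) = fun x => peval (a x) p + peval (a x) q).
    exact: lip_add.
  by apply/funext => x; rewrite /peval mevalD.
- rewrite (_ : (fun x => _) = fun x => peval (a x) p * peval (a x) q).
    exact: lip_mul.
  by apply/funext => x; rewrite /peval mevalM.
Qed.

Lemma mx_norm_le n (x : 'cV[R]_n) (r : R) : 0 <= r ->
  (forall i, `|x i 0| <= r) -> `|x| <= r.
Proof.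
move=> r0 xr; rewrite [`|x|]mx_normrE; apply/bigmax_leP; split=> // -[i j] _ /=.
by rewrite (ord1 j).
Qed.

Lemma coord_norm_le n (x : 'cV[R]_n) i : `|x i 0| <= `|x|.
Proof.
rewrite [`|x|]mx_normrE.
exact: (le_bigmax _ (fun ij : 'I_n * 'I_1 => `|x ij.1 ij.2|) (i, 0)).
Qed.

Lemma lip_colvec n (a : U -> 'cV[R]_n) :
  (forall i, lip_on_balls (fun x => a x i 0)) -> lip_on_balls a.
Proof.
move=> al r.
have /choice[L Lp] : forall i, exists L : R, 0 <= L /\ forall x y,
    `|x| <= r -> `|y| <= r -> `|a x i 0 - a y i 0| <= L * `|x - y|.
  by move=> i; have [L L0 h] := al i r; exists L.
exists (\sum_i L i) => [|x y xr yr].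
  by apply: sumr_ge0 => i _; case: (Lp i).
apply: mx_norm_le => [|i].
  by rewrite mulr_ge0// sumr_ge0// => i _; case: (Lp i).
rewrite !mxE; apply: le_trans ((Lp i).2 _ _ xr yr) _.
rewrite ler_wpM2r// (bigD1 i)//= lerDl sumr_ge0// => j _.
by case: (Lp j).
Qed.

End Closure.

Lemma lip_on_balls_continuous (U V : normedModType R) (f : U -> V) :
  lip_on_balls f -> continuous f.
Proof.
move=> fl x; have [L L0 fL] := fl (`|x| + 1).
apply/cvgrPdist_lt => e e0.
have d0 : 0 < Num.min 1 (e / (L + 1)) by rewrite lt_min ltr01 divr_gt0// ltr_wpDl.
apply: filterS (nbhsx_ballx x _ d0) => y; rewrite -ball_normE/= => yx.
move: yx; rewrite lt_min => /andP[yx1 yxe].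
apply: (@le_lt_trans _ _ (L * `|x - y|)).
  apply: fL; first by rewrite lerDl.
  rewrite -[y](subrK x) addrC (le_trans (ler_normD _ _))// lerD2l distrC.
  exact: ltW.
apply: (@le_lt_trans _ _ ((L + 1) * `|x - y|)); first by rewrite ler_wpM2r// lerDl.
by rewrite mulrC -ltr_pdivlMr// ltr_wpDl.
Qed.

End PolynomialCalculus.

(** * Differential equations with piecewise continuous right-hand side *)

Section Antiderivative.
Context {R : realType}.
Local Notation mu := (@lebesgue_measure R).

Definition off_finite (P : R -> Prop) := forall T : R, 0 < T ->
  exists D : seq R, forall t, 0 < t < T -> t \notin D -> P t.

(** Each ]0, k + 1[ is a finite set together with an open set on which [f] is continuous. *)
Lemma measurable_off_finite (f : R -> R) :
  off_finite (fun t => {for t, continuous f}) ->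
  measurable_fun (`]0, +oo[ : set R) f.
Proof.
move=> fP.
rewrite (_ : `]0, +oo[%classic = \bigcup_k `]0, k.+1%:R[%classic); last first.
  apply/seteqP; split=> t /=; rewrite ?in_itv/= ?andbT.
    move=> t0; exists (Num.bound t) => //=; rewrite in_itv/= t0/=.
    apply: lt_trans (archi_boundP (ltW t0)) _; by rewrite ltr_nat.
  by move=> [k _]; rewrite /= in_itv/= => /andP[].
apply/measurable_fun_bigcup => k; first exact: measurable_itv.
have [D Dp] := fP k.+1%:R (ltr0Sn _ _).
pose E := [set t | t \in D] : set R.
have Efin : finite_set E by exact: finite_seq.
have mE (A : set R) : A `<=` E -> measurable A.
  move=> AE; apply: countable_measurable => [t|]; first exact: measurable_set1.
  by apply/finite_set_countable/(sub_finite_set AE).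
have Eo : open (~` E).
  apply: closed_openC; apply: (proj1 accessible_finite_set_closed) => //.
  exact/hausdorff_accessible/Rhausdorff.
rewrite -[X in measurable_fun X]setIT -(setUv E) setIUr.
have mEC : measurable (~` E) by apply: measurableC; exact: mE.
have mIE : measurable (`]0, k.+1%:R[ `&` E) by apply: mE => t [].
have mIEC : measurable (`]0, k.+1%:R[ `&` ~` E).
  by apply: measurableI mEC; exact: measurable_itv.
apply/(measurable_funU f mIE mIEC); split.
- by move=> mI B mB; apply: mE => t [[]].
- apply: measurable_realfun.open_continuous_measurable_fun.
    by apply: openI => //; exact: interval_open.
  move=> t /[!inE]-[/=]; rewrite in_itv/= => t0k tE; apply: Dp => //.
  exact/negP.
Qed.

Lemma nonneg_part_continuous : continuous (fun t : R => Num.max t 0).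
Proof. by move=> t; apply: continuous_max; [exact: cvg_id | exact: cvg_cst]. Qed.

(** Extended by zero, [f] is bounded and measurable, so its Lebesgue integral is continuous and, by
    the fundamental theorem of calculus, differentiable at the positive continuity points of [f]. *)
Lemma antiderivative (f : R -> R) (M : R) :
  off_finite (fun t => {for t, continuous f}) -> (forall t, 0 < t -> `|f t| <= M) ->
  exists F : R -> R, [/\ continuous F, F 0 = 0 &
    forall t, 0 < t -> {for t, continuous f} -> is_derive t 1 F (f t)].
Proof.
move=> fP fM; pose g := f \_ `]0, +oo[%classic.
have mg : measurable_fun setT g.
  have mp : measurable (`]0, +oo[ : set R) by exact: measurable_itv.
  by apply/(measurable_restrictT f mp); exact: measurable_off_finite.
have gM t : `|g t| <= `|M|.
  rewrite /g patchE; case: ifPn => [|_]; last by rewrite normr0.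
  rewrite inE/= in_itv/= andbT => /fM /le_trans; apply; exact: ler_norm.
have gint (u : R) : mu.-integrable `[-1, u] (EFin \o g).
  apply: measurable_bounded_integrable.
  - exact: measurable_itv.
  - by rewrite /= lebesgue_measure_itv/=; case: ifP => // _; rewrite -EFinD ltry.
  - exact: measurable_funS mg.
  - exists `|M|; split; first exact: num_real.
    by move=> x Mx t _; exact: le_trans (gM t) (ltW Mx).
(* Starting at -1 makes 0 an interior point, where [I] is continuous from both sides; [F] is then
   frozen at negative times. *)
pose I x := parameterized_integral mu (-1) x g.
have Ic (x : R) : -1 < x -> {for x, continuous I}.
  move=> x1; have x1' : -1 <= x + 1 by lra.
  apply: (within_continuous_continuous _
    (parameterized_integral_continuous x1' (gint _))).
    by lra.
  by rewrite in_itv/= x1/= ltrDl.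
exists (fun t => I (Num.max t 0) - I 0); split.
- move=> t; apply: cvgB; last exact: cvg_cst.
  apply: (@continuous_comp _ _ _ (fun t : R => Num.max t 0) I).
    exact: nonneg_part_continuous.
  by apply: Ic; rewrite lt_max; apply/orP; right; lra.
- by rewrite maxxx subrr.
- move=> t t0 ft.
  have near_pos : \forall s \near t, 0 < s by exact: lt_nbhsr.
  have gt : g t = f t by rewrite /g patchE mem_set//= in_itv/= t0.
  have gc : {for t, continuous g}.
    rewrite /prop_for /continuous_at gt; apply: cvg_trans ft.
    apply: near_eq_cvg; near=> s.
    by rewrite /g patchE mem_set//= in_itv/= andbT; near: s.
  have t1 : t < t + 1 by rewrite ltrDl.
  have tN1 : -1 < t by lra.
  have [] := continuous_FTC1_closed t1 (gint _) tN1 gc.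
  rewrite -/I gt => It Ite.
  apply: (@near_eq_is_derive _ _ _ (fun s => I s - I 0)).
    near=> s; congr (I _ - _); apply/esym/max_idPl/ltW; near: s; exact: near_pos.
  rewrite -[f t]subr0; apply: is_deriveB.
  by apply: DeriveDef; [exact: It | rewrite -derive1E; exact: Ite].
Unshelve. all: by end_near. Qed.

End Antiderivative.

(** * Global Picard iteration in an exponentially weighted norm *)

Section Picard.
Context {R : realType}.

Lemma le_of_geometric (a b c : R) : 0 <= c ->
  (forall k, a <= b + c * 2^-1 ^+ k) -> a <= b.
Proof.
move=> c0 h; apply/ler_addgt0Pr => e e0.
pose k := Num.bound (c / e); apply: le_trans (h k) _; rewrite lerD2l.
rewrite exprVn ler_pdivrMr ?exprn_gt0// mulrC -ler_pdivrMr//.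
have ce : 0 <= c / e by rewrite divr_ge0// ltW.
apply: ltW; apply: lt_le_trans (archi_boundP ce) _.
by rewrite -natrX ler_nat ltnW// ltn_expl.
Qed.

Lemma geometric_limit (u : nat -> R) (c : R) : 0 <= c ->
  (forall k, `|u k.+1 - u k| <= c * 2^-1 ^+ k) ->
  exists l, forall k, `|l - u k| <= 2 * c * 2^-1 ^+ k.
Proof.
move=> c0 du.
(* [w k] is the sum of the remaining increments, so u - w increases, u + w decreases, and the
   supremum of the former lies between them. *)
pose w k := 2 * c * 2^-1 ^+ k.
have w0 k : 0 <= w k by rewrite !mulr_ge0// exprn_ge0.
have wS k : c * 2^-1 ^+ k = w k - w k.+1 by rewrite /w exprS; field.
have up : {homo (fun k => u k - w k) : j k / (j <= k)%N >-> j <= k}.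
  apply: homo_leq => [//|? ? ? |k]; first exact: le_trans.
  by have := du k; rewrite wS ler_norml => /andP[]; lra.
have dn : {homo (fun k => u k + w k) : j k / (j <= k)%N >-> k <= j}.
  apply: (@homo_leq _ _ (fun a b => b <= a)) => [//|a b d h1 h2|k].
    exact: le_trans h2 h1.
  by have := du k; rewrite wS ler_norml => /andP[]; lra.
have cross j k : u j - w j <= u k + w k.
  have [jk|/ltnW kj] := leqP j k.
    by apply: le_trans (up _ _ jk) _; have := w0 k; lra.
  by apply: le_trans _ (dn _ _ kj); have := w0 j; lra.
pose S := [set u k - w k | k in [set: nat]].
have S0 : S !=set0 by exists (u 0%N - w 0%N), 0%N.
exists (sup S) => k; rewrite -/(w k) ler_norml; apply/andP; split.
  suff : u k - w k <= sup S by lra.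
  apply: ub_le_sup; last by exists k.
  by exists (u 0%N + w 0%N) => _ [j _ <-].
suff : sup S <= u k + w k by lra.
by apply: ge_sup => // _ [j _ <-].
Qed.

(** Subtracting the primitive K / lam e^(lam t) of the bound leaves a nonincreasing function.
    Dividing by lam is what makes the Picard map contract. *)
Lemma exp_growth_side (h dh : R -> R) (P : R -> Prop) (lam K T : R) :
  0 < lam -> 0 <= K -> 0 <= T -> continuous h -> h 0 = 0 -> off_finite P ->
  (forall t, 0 < t -> P t -> is_derive t 1 h (dh t)) ->
  (forall t, 0 < t -> dh t <= K * expR (lam * t)) ->
  h T <= K / lam * expR (lam * T).
Proof.
move=> lam0 K0; rewrite le_eqVlt => /predU1P[<-|T0] ch h0 Pf dhE dhK.
  by rewrite h0 mulr_ge0 ?expR_ge0// divr_ge0// ltW.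
have [D Dp] := Pf _ T0.
pose e t := K / lam * expR (lam * t).
have de (t : R) : is_derive t 1 e (K * expR (lam * t)).
  have dlin : is_derive t 1 (fun s : R => lam * s) lam.
    have := @is_deriveZ _ _ _ (@id R) lam t 1 1 (is_derive_id _ _).
    by rewrite [lam *: _]mulr1.
  have dexp := @is_derive1_comp _ expR (fun s : R => lam * s) t _ _
    (is_derive_expR _) dlin.
  have := is_deriveZ (K / lam) dexp.
  have -> : (K / lam) *: (expR (lam * t) * lam) = K * expR (lam * t).
    by rewrite [LHS]mulrCA divfK ?gt_eqF// mulrC.
  exact.
have cf : continuous (fun t => h t - e t).
  move=> t; apply: cvgB; first exact: ch.
  apply: cvgMr.
  apply: (@continuous_comp _ _ _ (fun s : R => lam * s) expR).
    by apply: cvgMr; exact: cvg_id.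
  exact: continuous_expR.
have := @derive_le_off_finite _ (fun t => h t - e t) D 0 0 T (ltW T0) cf.
rewrite mul0r h0 sub0r opprK => /(_ _)/wrap[t /andP[t0 tT] tD|].
  have Pt : P t by apply: Dp tD; rewrite t0.
  have [dht hE] := is_deriveB (dhE t t0 Pt) (de t).
  by split; [exact: dht | rewrite hE subr_le0 dhK].
rewrite /e mulr0 expR0 mulr1 => hT.
have : 0 <= K / lam by rewrite divr_ge0// ltW.
by move: hT; rewrite /e; lra.
Qed.

Section VectorGrowth.
Variables (n : nat) (h dh : R -> 'cV[R]_n) (P : R -> Prop).
Hypotheses (ch : continuous h) (Pf : off_finite P).
Hypothesis dhE : forall t, 0 < t -> P t -> is_derive t 1 h (dh t).

Lemma coord_is_derive (t : R) i : 0 < t -> P t ->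
  is_derive t 1 (fun s => h s i 0) (dh t i 0).
Proof. by move=> t0 Pt; apply: is_derive_coord; exact: dhE. Qed.

Lemma coord_curve_continuous i : continuous (fun s => h s i 0).
Proof.
move=> s; apply: (@continuous_comp _ _ _ h (fun A : 'cV[R]_n => A i 0)).
  exact: ch.
exact: coord_continuous.
Qed.

Lemma exp_growth (lam K T : R) : 0 < lam -> 0 <= K -> 0 <= T -> h 0 = 0 ->
  (forall t, 0 < t -> `|dh t| <= K * expR (lam * t)) ->
  `|h T| <= K / lam * expR (lam * T).
Proof.
move=> lam0 K0 T0 h0 dhK; apply: mx_norm_le => [|i].
  by rewrite mulr_ge0 ?expR_ge0// divr_ge0// ltW.
have dhi t : 0 < t -> `|dh t i 0| <= K * expR (lam * t).
  by move=> t0; apply: le_trans (dhK t t0); exact: coord_norm_le.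
rewrite ler_norml lerNl; apply/andP; split.
  apply: (@exp_growth_side (fun s => - h s i 0) (fun s => - dh s i 0) P) => //.
  - by move=> s; apply: cvgN; exact: coord_curve_continuous.
  - by rewrite h0 mxE oppr0.
  - by move=> t t0 Pt; apply: is_deriveN; exact: coord_is_derive.
  - by move=> t /dhi; rewrite ler_norml => /andP[+ _]; rewrite lerNl.
apply: (@exp_growth_side (fun s => h s i 0) (fun s => dh s i 0) P) => //.
- exact: coord_curve_continuous.
- by rewrite h0 mxE.
- by move=> t t0 Pt; exact: coord_is_derive.
- by move=> t /dhi; rewrite ler_norml => /andP[].
Qed.

Lemma curve_lipschitz (M a b : R) : 0 <= M -> 0 <= a -> a <= b ->
  (forall t, 0 < t -> `|dh t| <= M) -> `|h b - h a| <= M * (b - a).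
Proof.
move=> M0 a0 ab dhM; apply: mx_norm_le => [|i].
  by rewrite mulr_ge0// subr_ge0.
have [b0|b0] := leP b 0.
  have -> : b = a by apply/le_anti; rewrite ab (le_trans b0).
  by rewrite subrr mxE normr0 subrr mulr0.
have [D Dp] := Pf b0.
have inD t : a < t < b -> t \notin D -> 0 < t /\ P t.
  move=> /andP[at_ tb] tD; have t0 := le_lt_trans a0 at_.
  by split=> //; apply: Dp tD; rewrite t0.
have dhi t : 0 < t -> `|dh t i 0| <= M.
  by move=> /dhM; apply: le_trans; exact: coord_norm_le.
rewrite !mxE ler_norml lerNl opprB; apply/andP; split.
  have := @derive_le_off_finite _ (fun s => - h s i 0) D M a b ab.
  rewrite opprK addrC; apply=> [s|t tab tD].
    by apply: cvgN; exact: coord_curve_continuous.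
  have [t0 Pt] := inD t tab tD.
  have [ex e] := is_deriveN (coord_is_derive i t0 Pt).
  split; first exact: ex.
  by rewrite e; have := dhi t t0; rewrite ler_norml => /andP[+ _]; rewrite lerNl.
apply: (@derive_le_off_finite _ (fun s => h s i 0) D M a b ab).
  exact: coord_curve_continuous.
move=> t tab tD; have [t0 Pt] := inD t tab tD.
have [ex e] := coord_is_derive i t0 Pt; split; first exact: ex.
by rewrite e; have := dhi t t0; rewrite ler_norml => /andP[].
Qed.

End VectorGrowth.

Lemma continuous_colvec (T : topologicalType) n (y : T -> 'cV[R]_n) t :
  (forall i, {for t, continuous (fun s => y s i 0)}) -> {for t, continuous y}.
Proof.
move=> yc; apply/cvgrPdist_le => e e0.
have : \forall s \near t, forall i, `|y t i 0 - y s i 0| <= e.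
  apply: filter_forall => i.
  exact: (proj1 (cvgrPdist_le _ _) (yc i)).
apply: filterS => s ys; apply: mx_norm_le; first exact: ltW.
by move=> i; rewrite !mxE.
Qed.

Lemma is_derive_colvec n (y : R -> 'cV[R]_n) (dy : 'cV[R]_n) (t : R) :
  (forall i, is_derive t 1 (fun s => y s i 0) (dy i 0)) -> is_derive t 1 y dy.
Proof.
move=> yd; have dy1 : derivable y t 1.
  by apply/derivable_mxP => i j; rewrite (ord1 j); case: (yd i).
apply: DeriveDef => //; rewrite derive_mx//; apply/colP => i; rewrite !mxE.
by case: (yd i).
Qed.

Section PicardIteration.
Variables (n : nat) (G : R -> 'cV[R]_n -> 'cV[R]_n) (P : R -> Prop).
Variables (L M : R) (x0 : 'cV[R]_n).
Hypotheses (Pf : off_finite P) (L0 : 0 < L) (M0 : 0 <= M).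
Hypothesis GL : forall t x y, 0 < t -> `|G t x - G t y| <= L * `|x - y|.
Hypothesis GM : forall t x, 0 < t -> `|G t x| <= M.
Hypothesis Gc : forall x : R -> 'cV[R]_n, continuous x ->
  forall t, 0 < t -> P t -> {for t, continuous (fun s => G s (x s))}.

(** The Picard operator as a relation, the integral of [G s (x s)] being characterized by
    continuity, initial value and derivative. *)
Definition picard_image (x y : R -> 'cV[R]_n) := [/\ continuous y, y 0 = x0 &
  forall t, 0 < t -> P t -> is_derive t 1 y (G t (x t))].

(** Continuity of [x] stands under the existential, so that choice gives an operator on all
    functions; discontinuous ones get an arbitrary value. *)
Lemma picard_image_ex (x : R -> 'cV[R]_n) :
  exists y, continuous x -> picard_image x y.
Proof.
have [xc|xc] := pselect (continuous x); last by exists x.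
have Gci i t : 0 < t -> P t -> {for t, continuous (fun s => G s (x s) i 0)}.
  move=> t0 Pt.
  apply: (@continuous_comp _ _ _ (fun s => G s (x s)) (fun A : 'cV[R]_n => A i 0)).
    exact: Gc.
  exact: coord_continuous.
have /choice[F FP] : forall i : 'I_n, exists F : R -> R,
    [/\ continuous F, F 0 = 0 & forall t, 0 < t -> P t ->
      is_derive t 1 F (G t (x t) i 0)].
  move=> i; have [||F [Fc F0 Fd]] := @antiderivative _ (fun s => G s (x s) i 0) M.
  - move=> T T0; have [D Dp] := Pf T0; exists D => t /[dup] /andP[t0 _] tT tD.
    exact/Gci/Dp.
  - by move=> t t0; apply: le_trans (GM (x t) t0); exact: coord_norm_le.
  exists F; split=> // t t0 Pt; apply: Fd => //; exact: Gci.
exists (fun t => \col_i (x0 i 0 + F i t)) => _; split.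
- move=> t; apply: continuous_colvec => i; have [Fc _ _] := FP i.
  rewrite (_ : (fun s => _) = fun s => x0 i 0 + F i s); last first.
    by apply/funext => s; rewrite mxE.
  by apply: cvgD; [exact: cvg_cst | exact: Fc].
- by apply/colP => i; have [_ F0 _] := FP i; rewrite mxE F0 addr0.
- move=> t t0 Pt; apply: is_derive_colvec => i; have [_ _ Fd] := FP i.
  rewrite (_ : (fun s => _) = cst (x0 i 0) + F i); last first.
    by apply/funext => s; rewrite mxE.
  rewrite -[G _ _ _ _]add0r; apply: is_deriveD; exact: Fd.
Qed.

(** With weight e^(2 L t), integration divides the Lipschitz constant L by 2 L, which gives the
    factor 1/2 on the entire half-line. *)
Lemma picard_contract (x x' y y' : R -> 'cV[R]_n) (K : R) : 0 <= K ->
  picard_image x y -> picard_image x' y' ->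
  (forall t, 0 <= t -> `|x t - x' t| <= K * expR (2 * L * t)) ->
  forall t, 0 <= t -> `|y t - y' t| <= K * 2^-1 * expR (2 * L * t).
Proof.
move=> K0 [yc y0 yd] [yc' y0' yd'] xx t t0.
have -> : K * 2^-1 = L * K / (2 * L) by field; rewrite gt_eqF.
apply: (@exp_growth n (fun s => y s - y' s) (fun s => G s (x s) - G s (x' s)) P) => //.
- by move=> s; apply: cvgB; [exact: yc | exact: yc'].
- by move=> s s0 Ps; apply: is_deriveB; [exact: yd | exact: yd'].
- by rewrite mulr_gt0.
- by rewrite mulr_ge0// ltW.
- by rewrite y0 y0' subrr.
- move=> s s0; apply: le_trans (GL _ _ s0) _.
  by rewrite -mulrA ler_pM2l// xx// ltW.
Qed.

Theorem picard_exists : exists x : R -> 'cV[R]_n, [/\ continuous x, x 0 = x0 &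
  forall t, 0 < t -> P t -> is_derive t 1 x (G t (x t))].
Proof.
have /choice[I IP] := picard_image_ex.
pose u k := iter k I (fun=> x0).
have uc k : continuous (u k).
  elim: k => [|k IH]; first by move=> t; exact: cvg_cst.
  by have [] := IP _ IH.
have uP k : picard_image (u k) (u k.+1) by apply: IP; exact: uc.
have lam0 : 0 < 2 * L by rewrite mulr_gt0.
pose K := M / (2 * L); have K0 : 0 <= K by rewrite divr_ge0// ltW.
have du k t : 0 <= t -> `|u k.+1 t - u k t| <= K * 2^-1 ^+ k * expR (2 * L * t).
  elim: k t => [|k IH] t t0.
    have [c1 e1 d1] := uP 0%N; rewrite expr0 mulr1.
    apply: (@exp_growth n (fun s => u 1%N s - x0) (fun s => G s x0) P) => //.
    - by move=> s; apply: cvgB; [exact: c1 | exact: cvg_cst].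
    - move=> s s0 Ps; rewrite -[G s x0]subr0.
      by apply: is_deriveB; exact: d1.
    - by rewrite e1 subrr.
    - move=> s s0; apply: le_trans (GM _ s0) _; rewrite ler_peMr//.
      by apply: le_trans (expR_ge1Dx _); rewrite lerDl mulr_ge0// ltW.
  rewrite exprSr mulrA; apply: (picard_contract _ (uP k.+1) (uP k)) => //.
  by rewrite mulr_ge0// exprn_ge0.
pose c t := K * expR (2 * L * t).
have c0 t : 0 <= c t by rewrite mulr_ge0// expR_ge0.
have w0 t k : 0 <= 2 * c t * 2^-1 ^+ k.
  by apply: mulr_ge0; [apply: mulr_ge0 | apply: exprn_ge0].
have /choice[l lP] : forall t, exists l : 'cV[R]_n, 0 <= t ->
    forall k, `|l - u k t| <= 2 * c t * 2^-1 ^+ k.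
  move=> t; have [t0|t0] := boolP (0 <= t); last by exists 0.
  have /choice[l lP] : forall i, exists l, forall k,
      `|l - u k t i 0| <= 2 * c t * 2^-1 ^+ k.
    move=> i; apply: geometric_limit => // k.
    have := coord_norm_le (u k.+1 t - u k t) i; rewrite !mxE => /le_trans; apply.
    by apply: le_trans (du k t t0) _; rewrite /c mulrAC.
  exists (\col_i l i) => _ k; apply: mx_norm_le => [|i]; first exact: w0.
  by rewrite !mxE.
have l0 : l 0 = x0.
  apply/eqP; rewrite -subr_eq0 -normr_le0.
  apply: (@le_of_geometric _ _ (2 * c 0)); first by rewrite mulr_ge0.
  move=> k; rewrite add0r -[x in _ - x](_ : u k 0 = x0); first exact: lP.
  by case: k => [//|k]; case: (uP k).
have lLip a b : 0 <= a -> a <= b -> `|l b - l a| <= M * (b - a).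
  move=> a0 ab; have b0 := le_trans a0 ab.
  apply: (@le_of_geometric _ _ (2 * c a + 2 * c b)).
    by rewrite addr_ge0// mulr_ge0.
  move=> k.
  have half t : 2 * c t * 2^-1 ^+ k.+1 <= 2 * c t * 2^-1 ^+ k.
    by rewrite exprS mulrCA ler_piMl// ?w0//; lra.
  have uab : `|u k.+1 b - u k.+1 a| <= M * (b - a).
    have [c1 e1 d1] := uP k.
    by apply: (@curve_lipschitz n (u k.+1) (fun s => G s (u k s)) P) => // t; exact: GM.
  have lb := le_trans (lP b b0 k.+1) (half b).
  have la := le_trans (lP a a0 k.+1) (half a).
  have := ler_distD (u k.+1 b) (l b) (l a).
  have := ler_distD (u k.+1 a) (u k.+1 b) (l a).
  by rewrite (distrC (u k.+1 a) (l a)) mulrDl; lra.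
(* The limit [l] is controlled only for t >= 0, where it inherits the Lipschitz constant M of the
   iterates; freezing it before 0 gives a function continuous on R. *)
pose z t := l (Num.max t 0).
have zc : continuous z.
  move=> t; apply/cvgrPdist_lt => e e0.
  have d0 : 0 < e / (M + 1) by rewrite divr_gt0// ltr_wpDl.
  apply: filterS (nbhsx_ballx t _ d0) => s; rewrite -ball_normE/= => ts.
  have zLip : `|z t - z s| <= M * `|t - s|.
    wlog st : s t {ts} / s <= t.
      move=> W; have [/W//|/ltW/W] := leP s t; by rewrite distrC (distrC s).
    apply: le_trans (lLip _ _ _ _) _; first by rewrite le_max lexx orbT.
      by rewrite ge_max !le_max st lexx orbT.
    rewrite ler_wpM2l// ger0_norm ?subr_ge0//.
    by case: (leP t 0) => ?; case: (leP s 0) => ?; lra.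
  apply: le_lt_trans zLip _; apply: (@le_lt_trans _ _ ((M + 1) * `|t - s|)).
    by rewrite ler_wpM2r// lerDl.
  by rewrite mulrC -ltr_pdivlMr// ltr_wpDl.
have zl t : 0 <= t -> z t = l t by move=> t0; rewrite /z max_l.
(* [I z] has derivative [G t (z t)], so it remains to identify it with [z] at positive times: both
   are geometrically close to the iterates. *)
exists (I z); have [Izc Iz0 Izd] := IP _ zc; split=> // t t0 Pt.
suff <- : z t = I z t by exact: Izd.
rewrite zl ?ltW//; apply/eqP; rewrite -subr_eq0 -normr_le0.
apply: (@le_of_geometric _ _ (4 * c t)); first by rewrite mulr_ge0.
move=> k; rewrite add0r.
have zu s : 0 <= s -> `|z s - u k s| <= 2 * K * 2^-1 ^+ k * expR (2 * L * s).
  move=> s0; rewrite zl//; apply: le_trans (lP s s0 k) _.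
  by rewrite /c !mulrA mulrAC.
have K2 : 0 <= 2 * K * 2^-1 ^+ k.
  by apply: mulr_ge0; [apply: mulr_ge0 | apply: exprn_ge0].
have Iu := picard_contract K2 (IP _ zc) (uP k) zu (ltW t0).
have lu := lP t (ltW t0) k.+1.
have := ler_distD (u k.+1 t) (l t) (I z t); rewrite (distrC (u k.+1 t)).
move=> /le_trans; apply; apply: le_trans (lerD lu Iu) _.
have := w0 t k; rewrite /c exprSr.
set q := 2^-1 ^+ k; set E := expR _.
have -> : 2 * (K * E) * (q * 2^-1) + 2 * K * q * 2^-1 * E = 2 * (K * E) * q.
  by field.
have -> : 4 * (K * E) * q = 2 * (K * E) * q + 2 * (K * E) * q by ring.
by rewrite lerDl.
Qed.

End PicardIteration.
End Picard.

(** * Lyapunov functions and input-to-state stability *)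

Section InputToStateStability.
Context {R : realType}.

Lemma enorm_ge0 n (x : 'cV[R]_n) : 0 <= enorm x.
Proof. exact: sqrtr_ge0. Qed.

Lemma mx_norm_le_enorm n (x : 'cV[R]_n) : `|x| <= enorm x.
Proof.
apply: mx_norm_le => [|i]; first exact: enorm_ge0.
rewrite -sqrtr_sqr ler_wsqrtr// (bigD1 i)//= lerDl.
by apply: sumr_ge0 => j _; apply: sqr_ge0.
Qed.

Lemma continuous_nonneg_part (T : topologicalType) (x : R -> T) :
  {within `[0, +oo[, continuous x} -> continuous (fun t : R => x (Num.max t 0)).
Proof.
move=> /subspace_continuousP xc t U /= Ux.
have max0 (s : R) : `[0, +oo[%classic (Num.max s 0).
  by rewrite /= in_itv/= andbT le_max lexx orbT.
have /(@nonneg_part_continuous R t) h := xc _ (max0 t) U Ux.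
have h' : \forall s \near t, `[0, +oo[%classic (Num.max s 0) ->
  U (x (Num.max s 0)) := h.
by apply: (filterS _ h') => s; apply; exact: max0.
Qed.

(** The retraction onto the ball of radius r of the maximum norm; it is 1-Lipschitz for that norm
    and bounds the truncated vector field. *)
Definition clamp n (r : R) (x : 'cV[R]_n) : 'cV[R]_n :=
  \col_i Num.max (- r) (Num.min r (x i 0)).

Lemma clamp_norm n (r : R) (x : 'cV[R]_n) : 0 <= r -> `|clamp r x| <= r.
Proof.
move=> r0; apply: mx_norm_le => // i; rewrite mxE ler_norml le_max lexx/=.
rewrite ge_max; apply/andP; split; first by lra.
by rewrite ge_min lexx.
Qed.

Lemma clamp_id n (r : R) (x : 'cV[R]_n) : `|x| <= r -> clamp r x = x.
Proof.
move=> xr; apply/colP => i; rewrite mxE.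
have := le_trans (coord_norm_le x i) xr; rewrite ler_norml => /andP[a b].
by rewrite min_r// max_r.
Qed.

Lemma clamp_lip n (r : R) (x y : 'cV[R]_n) : 0 <= r ->
  `|clamp r x - clamp r y| <= `|x - y|.
Proof.
move=> r0; apply: mx_norm_le => // i; rewrite !mxE.
have := coord_norm_le (x - y) i; rewrite !mxE; apply: le_trans.
move: (x i 0) (y i 0) => a b.
wlog ab : a b / a <= b.
  by move=> W; have [/W//|/ltW/W] := leP a b; rewrite distrC (distrC b).
have mx u w : u <= w -> 0 <= Num.max (- r) w - Num.max (- r) u <= w - u.
  by move=> uw; case: (leP (- r) u) => ?; case: (leP (- r) w) => ?; lra.
have mn u w : u <= w -> 0 <= Num.min r w - Num.min r u <= w - u.
  by move=> uw; case: (leP r u) => ?; case: (leP r w) => ?; lra.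
have /andP[m1 m2] := mn _ _ ab; move: m1; rewrite subr_ge0 => /[dup] m1.
move=> /mx/andP[m3 m4].
by rewrite distrC (distrC a) !ger0_norm ?subr_ge0//; lra.
Qed.

(* The decay estimate of the trajectory on [0, T] gives both the ISS bound and
   the a priori bound that makes maximal solutions global. *)
Section LyapunovISS.
Variables (n p : nat) (F : 'cV[R]_n -> 'cV[R]_p -> 'cV[R]_n).
Variables (V : mpolynomial R n) (a1 a2 a3 a4 b1 b3 : R -> R).
Hypotheses (F0 : F 0 0 = 0)
  (FL : lip_on_balls (fun z : 'cV[R]_n * 'cV[R]_p => F z.1 z.2)).
Hypotheses (a1K : Kfun a1) (a2K : Kfun a2) (a3K : Kfun a3) (a4K : Kfun a4).
Hypotheses (b1K : Kfun b1) (b3K : Kfun b3).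
Hypotheses (ab1 : forall u, 0 <= u -> u <= a1 (b1 u))
  (ab3 : forall u, 0 <= u -> u <= a3 (b3 u)).
Hypothesis Vbounds : forall x, a1 (enorm x) <= peval x V <= a2 (enorm x).
Hypothesis Vdecrease : forall x w,
  (gradient V x *m F x w) 0 0 <= - a3 (enorm x) + a4 (enorm w).

(** In the bound of [lyapunov_decay], the two terms in z form [decay] and the term in the supply c
    forms [gain]. *)
Let chi (u : R) : R := b1 (a2 (b3 (2 * u))).
Let decay (r t : R) : R := chi (a2 r / (1 + `|t|)) + b1 (a2 r / (1 + `|t|)).
Let gain (r : R) : R := chi (a4 r).

Let chiK : Kfun chi.
Proof.
exact: Kfun_comp b1K (Kfun_comp a2K (Kfun_comp b3K (Kfun_scale (ltr0Sn R 1)))).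
Qed.

Let decayKL : class_KL decay.
Proof. exact: (Kfun_class_KL (Kfun_add chiK b1K) a2K). Qed.

Let gainK : Kfun gain.
Proof. exact: Kfun_comp chiK a4K. Qed.

Lemma locally_lipschitz_of_balls : locally_lipschitz F.
Proof.
move=> z; have [L L0 Lp] := FL (`|z| + 1).
exists (ball z 1); first exact: nbhsx_ballx.
have zb y : ball z 1 y -> `|y| <= `|z| + 1.
  rewrite -ball_normE/= => /ltW zy; rewrite -[y](subrK z) addrC.
  by rewrite (le_trans (ler_normD _ _))// lerD2l distrC.
exists L; split; first exact: num_real.
move=> K LK [y y'] [/= /zb yb /zb yb']; apply: le_trans (Lp _ _ yb yb') _.
by rewrite ler_wpM2r// ltW.
Qed.

Section Trajectory.
Variables (v : R -> 'cV[R]_p) (omega : R).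
Hypotheses (vpc : piecewise_continuous v)
  (vb : forall s, 0 <= s -> enorm (v s) <= omega).

Let P t := {for t, continuous v}.

Let Pf : off_finite P.
Proof. by move=> T T0; have [[D Dp] _ _] := vpc T0; exists D. Qed.

Let omega0 : 0 <= omega.
Proof. by apply: le_trans (vb (lexx 0)); exact: enorm_ge0. Qed.

(** The equation is assumed only on ]0, T[, so the estimate also covers a truncated solution up to
    its first exit from the box. *)
Lemma trajectory_estimate (x : R -> 'cV[R]_n) (T : R) : 0 <= T -> continuous x ->
  (forall t, 0 < t < T -> P t -> is_derive t 1 x (F (x t) (v t))) ->
  enorm (x T) <= decay (enorm (x 0)) T + gain omega.
Proof.
move=> T0 xc xd.
have [D Dp] : exists D : seq R, forall t, 0 < t < T -> t \notin D -> P t.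
  have [T00|Tpos] := leP T 0; last exact: Pf.
  by exists [::] => t /andP[t0 tT]; move: (lt_trans t0 tT); rewrite ltNge T00.
have yc : continuous (fun t => peval (x t) V).
  move=> t; apply: (@continuous_comp _ _ _ x (fun z => peval z V)); first exact: xc.
  apply: lip_on_balls_continuous; apply: (lip_peval (a := id)) => i r.
  exists 1 => // y z _ _; rewrite mul1r.
  by have := coord_norm_le (y - z) i; rewrite !mxE.
have := @lyapunov_decay _ (fun t => peval (x t) V) (fun t => enorm (x t)) D T
  (a4 omega) a1 a2 a3 b1 b3 a1K a2K a3K b1K b3K ab1 ab3 T0 _ yc.
rewrite /decay /gain /chi (ger0_norm T0); apply.
- exact: Kfun_ge0.
- by move=> t; exact: enorm_ge0.
- by move=> t; exact: Vbounds.
- move=> t tT tD; have [ex e] := is_derive_peval V (xd t tT (Dp t tT tD)).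
  split; first exact: ex.
  rewrite e; apply: le_trans (Vdecrease _ _) _; rewrite lerD2l.
  case/andP: tT => t0 _.
  by apply: Kfun_le => //; [exact: enorm_ge0 | apply: vb; exact: ltW].
Qed.

Lemma solution_estimate (x0 : 'cV[R]_n) (x : R -> 'cV[R]_n) : solution F v x0 x ->
  forall t, 0 <= t -> enorm (x t) <= decay (enorm x0) t + gain omega.
Proof.
move=> [x00 xc xd] t t0.
have := @trajectory_estimate (fun s => x (Num.max s 0)) t t0
  (continuous_nonneg_part xc).
rewrite maxxx (max_l t0) x00; apply=> s /andP[s0 _] Ps.
apply: (@near_eq_is_derive _ _ _ x); last by rewrite max_l ?ltW//; exact: xd.
have : \forall s' \near s, 0 < s' by exact: lt_nbhsr.
by apply: filterS => s' s'0; rewrite max_l// ltW.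
Qed.

Lemma solution_exists (x0 : 'cV[R]_n) : exists x, solution F v x0 x.
Proof.
(* Since [decay] is nonincreasing in time, [rho] exceeds the a priori bound at every time by at
   least 1. *)
pose rho := decay (enorm x0) 0 + gain omega + 1.
have dec0 r t : 0 <= r -> 0 <= decay r t.
  move=> r0; have a0 : 0 <= a2 r / (1 + `|t|).
    by rewrite divr_ge0 ?addr_ge0// (Kfun_ge0 a2K).
  by rewrite addr_ge0// ?(Kfun_ge0 chiK)// (Kfun_ge0 b1K).
have gain0 : 0 <= gain omega by exact: Kfun_ge0 gainK _.
have rho0 : 0 <= rho.
  by apply: addr_ge0 => //; apply: addr_ge0 => //; exact/dec0/enorm_ge0.
pose r := Num.max rho omega.
have [L L0 Lp] := FL r.
have zr t x : 0 < t -> `|(clamp rho x, v t) : 'cV[R]_n * 'cV[R]_p| <= r.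
  move=> t0; rewrite prod_normE/= ge_max /r !le_max clamp_norm//=.
  by rewrite (le_trans (mx_norm_le_enorm _) (vb (ltW t0))) orbT.
have r0 : 0 <= r by rewrite le_max rho0.
have [|||||x [xc xx0 xd]] := @picard_exists _ n (fun t x => F (clamp rho x) (v t)) P
  (* L + 1 because a positive constant is required; L r bounds the truncated field because F
     vanishes at the origin. *)
  (L + 1) (L * r) x0 Pf.
- by rewrite ltr_wpDl.
- by rewrite mulr_ge0.
- move=> t x y t0; apply: le_trans (Lp _ _ (zr t x t0) (zr t y t0)) _.
  rewrite prod_normE/= subrr normr0 max_l//.
  by rewrite ler_pM// ?lerDl// clamp_lip.
- move=> t x t0; have := Lp _ 0 (zr t x t0).
  rewrite normr0 /= F0 !subr0 => /(_ r0) /le_trans; apply.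
  by rewrite ler_wpM2l// zr.
- move=> x xc t t0 Pt.
  apply: (@continuous_comp _ _ _ (fun s => (clamp rho (x s), v s))
    (fun z : 'cV[R]_n * 'cV[R]_p => F z.1 z.2)); last first.
    exact: lip_on_balls_continuous.
  have cc : {for t, continuous (fun s => clamp rho (x s))}.
    apply: (@continuous_comp _ _ _ x (clamp rho)); first exact: xc.
    apply: lip_on_balls_continuous => d; exists 1 => // y z _ _.
    by rewrite mul1r clamp_lip.
  exact: (cvg_pair cc Pt).
have x_rho t : 0 <= t -> `|x t| <= rho.
  move=> t0; rewrite leNgt; apply/negP => big.
  have nc : continuous (fun s => `|x s|) by move=> s; apply: cvg_norm; exact: xc.
  have est := @trajectory_estimate x.
  have x0_rho : `|x 0| < rho.
    apply: le_lt_trans (mx_norm_le_enorm _) _.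
    have := est 0 (lexx 0) xc; rewrite xx0 => /(_ _)/wrap[s /andP[s0]|].
      by move=> /(lt_trans s0); rewrite ltxx.
    by rewrite /rho; lra.
  (* Before this first exit time the truncation is inactive, so the estimate holds at [t1] and keeps
     the state strictly inside the box. *)
  have [t1 /andP[t10 _] [rt1 before]] := first_hit t0 nc x0_rho (ltW big).
  have := est t1 (ltW t10) xc => /(_ _)/wrap[s /andP[s0 st1] Ps|].
    have := xd s s0 Ps; rewrite clamp_id//; apply/ltW/before.
    by rewrite (ltW s0).
  apply/negP; rewrite -ltNge xx0; apply: lt_le_trans (mx_norm_le_enorm _).
  apply: lt_le_trans rt1; rewrite /rho.
  suff : decay (enorm x0) t1 <= decay (enorm x0) 0 by lra.
  have [_ _ mono _] := decayKL.
  by apply: mono; rewrite ?enorm_ge0// ?in_itv/= ?andbT// ltW.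
exists x; split=> //; first exact: continuous_subspaceT.
by move=> t t0 Pt; have := xd t t0 Pt; rewrite clamp_id// x_rho// ltW.
Qed.

End Trajectory.

Theorem ISS_of_lyapunov : ISS F.
Proof.
split=> //; first exact: locally_lipschitz_of_balls.
exists decay, gain; split; [exact: decayKL | exact: Kfun_class_K | ].
move=> x0 v vpc [C vC].
have vb s : 0 <= s -> enorm (v s) <= input_sup v.
  move=> s0; apply: ub_le_sup; last by exists s => //=; rewrite in_itv/= s0.
  by exists C => z [u /=]; rewrite in_itv/= andbT => u0 <-; exact: vC.
split; first exact: (solution_exists vpc vb).
by move=> x; apply: (solution_estimate vpc vb).
Qed.

End LyapunovISS.

End InputToStateStability.

(** * The polynomial closed loop and its sum-of-squares certificates *)

Section PolynomialSystem.
Context {R : realType} {n m N M : nat}.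
Variables (Z : 'cV[mpolynomial R n]_N) (W : 'M[mpolynomial R n]_(M, m)).
Variable k : 'cV[mpolynomial R n]_m.

Lemma closed_loop0 A B : map_mx (peval 0) Z = 0 -> map_mx (peval 0) k = 0 ->
  closed_loop Z W A B k 0 0 = 0.
Proof.
by move=> Z0 k0; rewrite /closed_loop /regressor Z0 k0 addr0 mulmx0 col_mx0 mulmx0.
Qed.

Lemma lip_closed_loop A B : lip_on_balls
  (fun z : 'cV[R]_n * 'cV[R]_m => closed_loop Z W A B k z.1 z.2).
Proof.
have lip1 i : lip_on_balls (fun z : 'cV[R]_n * 'cV[R]_m => z.1 i 0).
  move=> r; exists 1 => // x y _ _; rewrite mul1r prod_normE le_max.
  by have := coord_norm_le (x.1 - y.1) i; rewrite !mxE => ->.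
have lip2 i : lip_on_balls (fun z : 'cV[R]_n * 'cV[R]_m => z.2 i 0).
  move=> r; exists 1 => // x y _ _; rewrite mul1r prod_normE le_max.
  by have := coord_norm_le (x.2 - y.2) i; rewrite !mxE => ->; rewrite orbT.
apply: lip_colvec => i.
rewrite (_ : (fun z => _) = fun z : 'cV[R]_n * 'cV[R]_m =>
    \sum_j A i j * peval z.1 (Z j 0)
    + \sum_j B i j * \sum_l peval z.1 (W j l) * (peval z.1 (k l 0) + z.2 l 0)).
  apply: lip_add; apply: lip_sum => j; apply: lip_mul; first exact: lip_cst.
  - exact: lip_peval.
  - exact: lip_cst.
  - apply: lip_sum => l; apply: lip_mul; first exact: lip_peval.
    by apply: lip_add => //; exact: lip_peval.
apply/funext => z; rewrite /closed_loop /regressor mul_row_col !mxE.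
congr (_ + _); apply: eq_bigr => j _; rewrite !mxE//.
by congr (_ * _); apply: eq_bigr => l _; rewrite !mxE.
Qed.

End PolynomialSystem.

Section SumOfSquares.
Context {R : realType}.

Lemma sos_ge0 n (p : mpolynomial R n) (x : 'cV[R]_n) : sos p -> 0 <= peval x p.
Proof.
move=> [s ->]; rewrite /peval rmorph_sum sumr_ge0// => q _.
by rewrite rmorphXn/= sqr_ge0.
Qed.

Lemma sosmx_quad_ge0 n d (S : 'M[mpolynomial R n]_d) (x : 'cV[R]_n) v :
  sosmx S -> 0 <= dot v (map_mx (peval x) S *m v).
Proof.
move=> [e [P ->]]; rewrite /peval map_mxM -mulmxA dot_mull -map_trmx trmxK.
exact: dotvv_ge0.
Qed.

End SumOfSquares.

Theorem theorem4p1 (R : realType) (n m N M T : nat)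
  (Z : 'cV[mpolynomial R n]_N) (W : 'M[mpolynomial R n]_(M, m))
  (Zmon : forall i j, is_monomial (Z i j))
  (Wmon : forall i j, is_monomial (W i j))
  (Z0 : map_mx (peval 0) Z = 0)
  (Astar : 'M[R]_(n, N)) (Bstar : 'M[R]_(n, M))
  (us : 'I_T -> 'cV[R]_m) (xs xdots d : 'I_T -> 'cV[R]_n) (delta : R)
  (delta_gt0 : 0 < delta)
  (data_eq : forall i, xdots i =
     Astar *m map_mx (peval (xs i)) Z
     + Bstar *m map_mx (peval (xs i)) W *m us i + d i)
  (d_bound : forall i, enorm (d i) ^+ 2 <= delta)
  (opt_is_feasible : exists A B tau, opt_feasible Z W us xs xdots delta A B tau)
  (Abar : 'M[R]_(N + M)) (Bbar : 'M[R]_(N + M, n))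
  (opt_sol : opt_solution Z W us xs xdots delta Abar Bbar)
  (mu : R) (mu_gt0 : 0 < mu)
  (k : 'cV[mpolynomial R n]_m) (k0 : map_mx (peval 0) k = 0)
  (alpha1 alpha2 alpha3 alpha4 : {poly R})
  (V : mpolynomial R n) (lambda : mpolynomial R (n + m))
  (s_alpha1 s_alpha2 : mpolynomial R n) (s_lambda : mpolynomial R (n + m))
  (S_nabla : 'M[mpolynomial R (n + m)]_(1 + n + (N + M)))
  (s_alpha1_sos : sos s_alpha1) (s_alpha2_sos : sos s_alpha2)
  (s_lambda_sos : sos s_lambda) (S_nabla_sos : sosmx S_nabla)
  (alpha1P : even_comparison mu alpha1) (alpha2P : even_comparison mu alpha2)
  (alpha3P : even_comparison mu alpha3) (alpha4P : even_comparison mu alpha4)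
  (V_lower : forall x : 'cV[R]_n,
     peval x V - alpha1.[enorm x] = peval x s_alpha1)
  (V_upper : forall x : 'cV[R]_n,
     alpha2.[enorm x] - peval x V = peval x s_alpha2)
  (lambda_lower : forall (x : 'cV[R]_n) (w : 'cV[R]_m),
     peval2 x w lambda - mu = peval2 x w s_lambda)
  (LMI : forall (x : 'cV[R]_n) (w : 'cV[R]_m),
     let zetabar := - (invmx Abar *m Bbar) in
     let Qbar := 1%:M : 'M[R]_n in
     let l := regressor Z W x (map_mx (peval x) k + w) in
     let lam := peval2 x w lambda in
     symblock3
       ((alpha3.[enorm x] - alpha4.[enorm w])%:M
          + gradient V x *m zetabar^T *m l)
       (sqrtmx Qbar *m (gradient V x)^T)   (- (2 * lam)%:M)
       (lam *: (invmx (sqrtmx Abar) *m l)) 0                (- (2 * lam)%:M)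
     = - map_mx (peval2 x w) S_nabla) :
  (forall (A : 'M[R]_(n, N)) (B : 'M[R]_(n, M)),
     Ibar Abar Bbar (row_mx A B) -> ISS (closed_loop Z W A B k))
  /\ (Ibar Abar Bbar (row_mx Astar Bstar) /\ ISS (closed_loop Z W Astar Bstar k)).
Proof.
have [tau [feas _]] := opt_sol; have [pdA _ _] := feas.
(* For the true matrices the residual of the i-th data point is exactly the noise sample [d i]. *)
have IbarStar : Ibar Abar Bbar (row_mx Astar Bstar).
  apply: (opt_feasible_Ibar _ feas) => i.
  rewrite /regressor mul_row_col {1}data_eq mulmxA addrC addKr.
  exact: d_bound.
suff IbarISS A B : Ibar Abar Bbar (row_mx A B) -> ISS (closed_loop Z W A B k).
  by split=> //; split=> //; exact: IbarISS.
move=> [zeta zetaP zetaE].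
have [b1 b1K b1P] := even_comparison_inverse mu_gt0 alpha1P.
have [b3 b3K b3P] := even_comparison_inverse mu_gt0 alpha3P.
apply: (@ISS_of_lyapunov _ n m _ V (horner alpha1) (horner alpha2)
  (horner alpha3) (horner alpha4) b1 b3) => //.
- exact: closed_loop0.
- exact: lip_closed_loop.
- exact: even_comparison_Kfun alpha1P.
- exact: even_comparison_Kfun alpha2P.
- exact: even_comparison_Kfun alpha3P.
- exact: even_comparison_Kfun alpha4P.
- move=> x; rewrite -subr_ge0 V_lower sos_ge0//=.
  by rewrite -subr_ge0 V_upper sos_ge0.
- move=> x w; rewrite /closed_loop -zetaE mulmxA.
  set l := regressor _ _ _ _.
  have lam0 : 0 < peval2 x w lambda.
    have := sos_ge0 (col_mx x w) s_lambda_sos.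
    by rewrite -/(peval2 _ _ _) -lambda_lower; lra.
  suff : alpha3.[enorm x] - alpha4.[enorm w] + (gradient V x *m zeta^T *m l) 0 0 <= 0.
    by lra.
  (* The sum-of-squares matrix is positive semidefinite at each point, so (d) gives the pointwise
     matrix inequality. *)
  apply: (Ibar_dissipation pdA lam0 zetaP) => v.
  have := LMI x w; cbv zeta; rewrite -/l => ->.
  rewrite mulNmx dotNr oppr_le0; exact: sosmx_quad_ge0.
Qed.
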